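(* For every integer $r\geq 2$ and every real $\eta>0$, there exists $d_*=d_*(r,\eta)$ such that the following holds. Let $H$ be an $n$-vertex uncrowded $(r+1)$-uniform hypergraph with average degree $d\geq d_*$. Then $$\alpha(H)\geq (1-\eta)\,r^{-1/r}\left(\frac{\log d}{d}\right)^{1/r}n.$$
   Context: A (finite) hypergraph $H$ consists of a finite vertex set $V(H)$ and a set $E(H)$ of subsets of $V(H)$, called edges. It is $(r+1)$-uniform if every edge has exactly $r+1$ vertices. The average degree of an $n$-vertex $(r+1)$-uniform hypergraph is $d=\frac1n\sum_{v\in V(H)}|\{e\in E(H):v\in e\}|=(r+1)|E(H)|/n$. An independent set of $H$ is a set of vertices containing no edge of $H$ as a subset; the independence number $\alpha(H)$ is the size of a largest independent set. For $k\geq 2$, a Berge $k$-cycle $C_k$ is a sequence of distinct vertices $x_1,\ldots,x_k$ and distinct edges $e_1,\ldots,e_k$ such that $\{x_j,x_{j+1}\}\subseteq e_j$ for every $j$, with indices modulo $k$. A hypergraph is uncrowded if it contains no $C_k$ for $2\leq k\leq 4$. $\log$ denotes the natural logarithm. *)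

(* Defs.v *)
From mathcomp Require Import all_boot all_order all_algebra.
From mathcomp Require Import all_classical all_reals all_analysis.

Set Implicit Arguments.
Unset Strict Implicit.
Unset Printing Implicit Defensive.

Import Order.TTheory GRing.Theory Num.Theory.

Local Open Scope ring_scope.

(* A finite hypergraph is given by its vertex type [T : finType] and its edge
   set [E : {set {set T}}]. *)

Definition uniform (T : finType) (k : nat) (E : {set {set T}}) : Prop :=
  forall e : {set T}, e \in E -> #|e| = k.

Definition degree (T : finType) (E : {set {set T}}) (v : T) : nat :=
  #|[set e in E | v \in e]|.

(* Over an empty vertex type this is 0, since [0^-1 = 0]. *)
Definition average_degree (R : realType) (T : finType) (E : {set {set T}}) : R :=
  #|T|%:R^-1 * \sum_(v : T) (degree E v)%:R.

Definition independent (T : finType) (E : {set {set T}}) (S : {set T}) : bool :=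
  [forall e in E, ~~ (e \subset S)].

Definition independence_number (T : finType) (E : {set {set T}}) : nat :=
  \max_(S : {set T} | independent E S) #|S|.

(* [ordS] is the cyclic successor on ['I_k], so indices are taken modulo [k]. *)
Definition has_Berge_cycle (T : finType) (E : {set {set T}}) (k : nat) : Prop :=
  exists (x : 'I_k -> T) (e : 'I_k -> {set T}),
    [/\ injective x, injective e, forall j, e j \in E
      & forall j, [set x j; x (ordS j)] \subset e j].

Definition uncrowded (T : finType) (E : {set {set T}}) : Prop :=
  forall k : nat, (2 <= k <= 4)%N -> ~ has_Berge_cycle E k.

(* Main.v *)
(* The first step restricts [E] to a set [S] of vertices whose maximum degree [D]
   is essentially the average degree, by maximizing [|S|^(r+1) / (e(S) + b)] over
   all [S].

   On [S] the independent set is built in rounds. Every open vertex [v] carries a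
   number [x v], initially about [(ln D / (r D))^(1/r)]; in each round it is
   picked with probability [eps * x v], dies if some edge would otherwise be
   completed, and else has [x v] rescaled by the inverse of its survival
   probability, so that [x v] is the conditional probability of being picked in
   the end. Let [w v] be the sum over the edges [e] at [v] of the product of the
   values on [e :\ v]. Excluding 2-, 3- and 4-cycles makes the contributions of
   these edges independent in each round; surviving costs [w v] as much as it
   adds to [ln (x v)], so that the sum of [(x v)^2 exp (w v)] over the open
   vertices hardly increases in expectation. It starts with
   [x v * exp (w v) = D^(-eta'/r)] up to logarithms, hence the vertices for which
   [x v * exp (w v)] ever exceeds [D^(-eta'/(2r))] carry a negligible mass and
   can be discarded. All this only involves expectations of one potential, so in
   each round some outcome of the coins does at least as well as the average. *)

Require Import Defs.
From mathcomp Require Import all_boot all_order all_algebra.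
From mathcomp Require Import all_classical all_reals all_analysis.
From mathcomp Require Import ring lra.

Set Implicit Arguments.
Unset Strict Implicit.
Unset Printing Implicit Defensive.

Import Order.TTheory GRing.Theory Num.Theory.

Local Open Scope ring_scope.

(** * Expectations over independent coins *)

Definition bernoulli_weight (R : comPzRingType) (T : finType) (p : T -> R)
    (C : {set T}) : R :=
  \prod_v (if v \in C then p v else 1 - p v).

Definition expect (R : comPzRingType) (T : finType) (p : T -> R)
    (f : {set T} -> R) : R :=
  \sum_(C : {set T}) bernoulli_weight p C * f C.

Definition depends_on (T : finType) (U : Type) (f : {set T} -> U)
    (A : {set T}) : Prop :=
  forall C, f C = f (C :&: A).

Definition mix (T : finType) (A C D : {set T}) : {set T} :=
  (C :&: A) :|: (D :\: A).

Lemma mixI (T : finType) (A C D : {set T}) : mix A C D :&: A = C :&: A.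
Proof. by apply/finset.setP => v; rewrite !inE; case: (v \in A); rewrite ?andbF ?andbT ?orbF. Qed.

Lemma mixIC (T : finType) (A B C D : {set T}) :
  [disjoint A & B] -> mix A C D :&: B = D :&: B.
Proof.
move=> dAB; apply/finset.setP => v; rewrite !inE.
have [vB|] := boolP (v \in B); last by rewrite !andbF.
by rewrite (disjointFl dAB vB) andbF.
Qed.

Lemma mixK (T : finType) (A C D : {set T}) : mix A (mix A C D) (mix A D C) = C.
Proof.
by apply/finset.setP => v; rewrite !inE; case: (v \in A); rewrite ?andbF ?andbT ?orbF.
Qed.

Lemma depends_onS (T : finType) (U : Type) (f : {set T} -> U) (A B : {set T}) :
  A \subset B -> depends_on f A -> depends_on f B.
Proof.
by move=> sAB fA C; rewrite fA [RHS]fA -finset.setIA (finset.setIidPr sAB).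
Qed.

(* Exchanging the coins outside [A] between two independent copies preserves
   their joint law. *)
Lemma bernoulli_weight_mix (R : comPzRingType) (T : finType) (p : T -> R)
    (A C D : {set T}) :
  bernoulli_weight p (mix A C D) * bernoulli_weight p (mix A D C) =
  bernoulli_weight p C * bernoulli_weight p D.
Proof.
rewrite /bernoulli_weight -!big_split; apply: eq_bigr => v _ /=.
rewrite !inE; case: (v \in A); rewrite ?andbF ?andbT ?orbF //=.
by rewrite mulrC.
Qed.

Lemma bernoulli_weight_sum (R : comPzRingType) (T : finType) (p : T -> R) :
  \sum_(C : {set T}) bernoulli_weight p C = 1.
Proof.
rewrite /bernoulli_weight -(bigA_distr _ _ p (fun v => 1 - p v)).
by rewrite big1 // => v _; rewrite /= addrC subrK.
Qed.

Section ExpectRing.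
Context (R : comPzRingType) (T : finType) (p : T -> R).
Implicit Types (f g : {set T} -> R) (A B : {set T}).

Lemma expect_cst (c : R) : expect p (fun=> c) = c.
Proof. by rewrite /expect -mulr_suml bernoulli_weight_sum mul1r. Qed.

Lemma eq_expect f g : f =1 g -> expect p f = expect p g.
Proof. by move=> fg; apply: eq_bigr => C _; rewrite fg. Qed.

Lemma expectD f g : expect p (fun C => f C + g C) = expect p f + expect p g.
Proof. by rewrite /expect -big_split; apply: eq_bigr => C _; rewrite mulrDr. Qed.

Lemma expectN f : expect p (fun C => - f C) = - expect p f.
Proof. by rewrite /expect -sumrN; apply: eq_bigr => C _; rewrite mulrN. Qed.

Lemma expectZ (c : R) f : expect p (fun C => c * f C) = c * expect p f.
Proof. by rewrite /expect big_distrr; apply: eq_bigr => C _; rewrite mulrCA. Qed.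

Lemma expect_sum (I : finType) (P : pred I) (F : I -> {set T} -> R) :
  expect p (fun C => \sum_(i | P i) F i C) = \sum_(i | P i) expect p (F i).
Proof.
rewrite /expect exchange_big; apply: eq_bigr => C _.
by rewrite big_distrr.
Qed.

(** Introduce a second independent copy [D] of the coins and swap the coins outside [A]: this
    weight-preserving involution turns [g C] into [g D] and does not affect [f C]. *)
Lemma expectM f g A B : [disjoint A & B] -> depends_on f A -> depends_on g B ->
  expect p (fun C => f C * g C) = expect p f * expect p g.
Proof.
move=> dAB fA gB; pose w := bernoulli_weight p.
pose h (q : {set T} * {set T}) := (mix A q.1 q.2, mix A q.2 q.1).
have hK : involutive h by case=> C D; rewrite /h /= !mixK.
rewrite -[LHS]mulr1 -{1}(bernoulli_weight_sum p) /expect !big_distrlr /=.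
rewrite !pair_big /= (reindex_inj (inv_inj hK)) /=; apply: eq_bigr => -[C D] _ /=.
rewrite mulrAC bernoulli_weight_mix fA gB mixI mixIC // -fA -gB.
by rewrite !mulrA (mulrAC (w C)).
Qed.

Lemma depends_on_prod (I : finType) (P : pred I) (F : I -> {set T} -> R) A :
  (forall i, P i -> depends_on (F i) A) ->
  depends_on (fun C => \prod_(i | P i) F i C) A.
Proof. by move=> FA C; apply: eq_bigr => i Pi; exact: FA. Qed.

Lemma expect_prod (I : finType) (P : pred I) (F : I -> {set T} -> R)
    (A : I -> {set T}) :
  (forall i, P i -> depends_on (F i) (A i)) ->
  (forall i j, P i -> P j -> i != j -> [disjoint A i & A j]) ->
  expect p (fun C => \prod_(i | P i) F i C) = \prod_(i | P i) expect p (F i).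
Proof.
move=> FA dA; have [n] := ubnP #|P|; elim: n P FA dA => // n IHn P FA dA leP.
have [i Pi|P0] := pickP P; last first.
  rewrite [RHS]big_pred0 // -[RHS](expect_cst); apply: eq_expect => C.
  by rewrite big_pred0.
rewrite (bigD1 i) //= -IHn; first last.
- move: leP; rewrite ltnS; apply: leq_trans.
  have -> : #|P| = #|SimplPred P| by exact: eq_card.
  by rewrite (cardD1x Pi) add1n ltnS; apply/eq_leq/eq_card.
- by move=> j k /andP[Pj _] /andP[Pk _]; exact: dA.
- by move=> j /andP[Pj _]; exact: FA.
rewrite -(expectM (A := A i) (B := ~: A i)).
- by apply: eq_expect => C; rewrite (bigD1 i).
- by rewrite finset.disjoints_subset finset.setCK.
- exact: FA.
apply: depends_on_prod => j /andP[Pj ji].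
apply: depends_onS (FA j Pj); rewrite -finset.disjoints_subset.
by apply: dA => //.
Qed.

Lemma expect_mem (v : T) : expect p (fun C => (v \in C)%:R) = p v.
Proof.
(* Replacing the factor [1 - p v] by 0 removes exactly the outcomes that miss [v]. *)
pose F u : R := p u.
pose G u : R := if u == v then 0 else 1 - p u.
transitivity (\prod_u (F u + G u)); last first.
  rewrite (bigD1 v) //= big1 => [|u uv]; first by rewrite /G eqxx addr0 mulr1.
  by rewrite /F /G (negPf uv) /= addrC subrK.
rewrite bigA_distr; apply: eq_bigr => C _; rewrite /bernoulli_weight.
have [vC|vC] := boolP (v \in C).
  rewrite mulr1; apply: eq_bigr => u _; rewrite /F /G.
  by case: ifP => // uC; case: eqP => // uv; rewrite -uv uC in vC.
by rewrite mulr0 (bigD1 v) //= (negPf vC) /G eqxx mul0r.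
Qed.

End ExpectRing.

Section ExpectOrder.
Context (R : realFieldType) (T : finType) (p : T -> R).
Hypothesis p01 : forall v, 0 <= p v <= 1.
Implicit Types (f g : {set T} -> R).

Lemma bernoulli_weight_ge0 (C : {set T}) : 0 <= bernoulli_weight p C.
Proof.
by apply: prodr_ge0 => v _; have /andP[] := p01 v; case: ifP => _; rewrite ?subr_ge0.
Qed.

Lemma ler_expect f g : (forall C, f C <= g C) -> expect p f <= expect p g.
Proof. by move=> fg; apply: ler_sum => C _; rewrite ler_wpM2l ?bernoulli_weight_ge0. Qed.

(** First moment principle. Strictness in the contrapositive needs one outcome of nonzero weight,
    which exists because the weights sum to 1. *)
Lemma expect_exists f (c : R) : c <= expect p f -> exists C, c <= f C.
Proof.
move=> cf; apply/existsP; apply: contraLR cf; rewrite negb_exists => /forallP fc.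
rewrite -ltNge; suff: 0 < expect p (fun C => c - f C).
  by rewrite expectD expectN expect_cst subr_gt0.
have [C wC] : exists C, bernoulli_weight p C != 0.
  apply/existsP; apply: contraT; rewrite negb_exists => /forallP w0.
  have := bernoulli_weight_sum p; rewrite big1 => [/esym/eqP|C _]; first by rewrite oner_eq0.
  by apply/eqP; have := w0 C; rewrite negbK.
rewrite /expect (bigD1 C) //= ltr_pwDl //.
  apply: mulr_gt0; last by rewrite subr_gt0 ltNge fc.
  by rewrite lt_def wC bernoulli_weight_ge0.
by apply: sumr_ge0 => D _; rewrite mulr_ge0 ?bernoulli_weight_ge0 // subr_ge0 ltW // ltNge fc.
Qed.

End ExpectOrder.

(** * Short cycles in uncrowded hypergraphs *)

Section Uncrowded.
Context (T : finType) (E : {set {set T}}).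
Hypothesis uncE : uncrowded E.

Lemma uncrowded_tuple (k : nat) (x : k.-tuple T) (e : k.-tuple {set T}) :
  (2 <= k <= 4)%N -> uniq x -> uniq e -> {subset e <= E} ->
  (forall j : 'I_k, (tnth x j \in tnth e j) && (tnth x (ordS j) \in tnth e j)) ->
  False.
Proof.
move=> k24 /tuple_uniqP ux /tuple_uniqP ue eE xe; apply: (uncE k24).
exists (tnth x), (tnth e); split=> // j; first by apply/eE/mem_tnth.
by apply/fintype.subsetP => v; rewrite !inE; have /andP[? ?] := xe j; case/orP => /eqP ->.
Qed.

Lemma uncrowded2 (e f : {set T}) (a b : T) : e \in E -> f \in E -> a != b ->
  a \in e -> b \in e -> a \in f -> b \in f -> e = f.
Proof.
move=> eE fE ab ae be af bf; apply/eqP; apply: contraT => ef; exfalso.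
apply: (@uncrowded_tuple 2 [tuple a; b] [tuple e; f]) => //.
- by rewrite /= inE ab.
- by rewrite /= inE ef.
- by move=> g; rewrite !inE => /orP[] /eqP ->.
by case=> [[|[|//]]] ? /=; rewrite !(tnth_nth a) !(tnth_nth e) /= ?ae ?be ?af ?bf.
Qed.

(** The edge [f] may coincide with [e] or [g]: such a degenerate triangle reduces to
    [uncrowded2]. *)
Lemma uncrowded3 (e f g : {set T}) (a b c : T) :
  e \in E -> f \in E -> g \in E -> a != b -> b != c -> a != c ->
  a \in e -> b \in e -> b \in f -> c \in f -> c \in g -> a \in g -> e = g.
Proof.
move=> eE fE gE ab bc ac ae be bf cf cg ag; apply/eqP; apply: contraT => eg; exfalso.
have ef : e != f.
  by apply: contra_neq eg => ef; apply: (@uncrowded2 _ _ a c); rewrite ?ef // -ef.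
have fg : f != g.
  by apply: contra_neq eg => fg; apply: (@uncrowded2 _ _ a b); rewrite -?fg // fg.
apply: (@uncrowded_tuple 3 [tuple a; b; c] [tuple e; f; g]) => //.
- by rewrite /= !inE negb_or ab ac bc.
- by rewrite /= !inE negb_or ef eg fg.
- by move=> h; rewrite !inE => /or3P[] /eqP ->.
by case=> [[|[|[|//]]]] ? /=; rewrite !(tnth_nth a) !(tnth_nth e) /= ?ae ?be ?bf ?cf ?cg ?ag.
Qed.

(** Any coincidence left open by the hypotheses, among vertices or among edges, collapses the
    4-cycle to a shorter one, so that [uncrowded2] or [uncrowded3] applies. *)
Lemma uncrowded4 (e f f' e' : {set T}) (a b c b' : T) :
  e \in E -> f \in E -> f' \in E -> e' \in E ->
  a != b -> a != b' -> b != c -> b' != c ->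
  a \in e -> b \in e -> b \in f -> c \in f -> c \in f' -> b' \in f' ->
  b' \in e' -> a \in e' -> f != e -> f' != e' -> e = e'.
Proof.
move=> eE fE f'E e'E ab ab' bc b'c ae be bf cf cf' b'f' b'e' ae' fe f'e'.
apply/eqP; apply: contraT => ee'; exfalso.
have bb' : b != b'.
  by apply: contra_neq ee' => bb'; apply: (@uncrowded2 _ _ a b); rewrite // bb'.
have ac : a != c.
  by apply: contra_neq fe => ac; apply: (@uncrowded2 _ _ a b); rewrite // ac.
have ff' : f != f'.
  apply: contra_neq ee' => ff'.
  by apply: (@uncrowded3 e f e' a b b'); rewrite // ff'.
have fe' : f != e'.
  by apply: contra_neq ee' => fe'; apply: (@uncrowded2 _ _ a b); rewrite // -fe'.
have f'e : f' != e.
  by apply: contra_neq ee' => f'e; apply: (@uncrowded2 _ _ a b'); rewrite // -f'e.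
apply: (@uncrowded_tuple 4 [tuple a; b; c; b'] [tuple e; f; f'; e']) => //.
- by rewrite /= !inE !negb_or ab ac ab' bc bb' eq_sym b'c.
- by rewrite /= !inE !negb_or eq_sym fe eq_sym f'e ee' ff' fe' f'e'.
- by move=> h; rewrite !inE => /or4P[] /eqP ->.
by case=> [[|[|[|[|//]]]]] ? /=;
  rewrite !(tnth_nth a) !(tnth_nth e) /= ?ae ?be ?bf ?cf ?cf' ?b'f' ?b'e' ?ae'.
Qed.

End Uncrowded.

(** * Elementary real inequalities *)

Section RealBounds.
Context (R : realType).

(** Weierstrass product inequality; the nonnegativity of the product is carried along in the
    induction. *)
Lemma prod_1m_ge (I : finType) (P : pred I) (a : I -> R) :
  (forall i, P i -> 0 <= a i <= 1) ->
  1 - \sum_(i | P i) a i <= \prod_(i | P i) (1 - a i) <= 1.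
Proof.
move=> a01.
suff /and3P[-> _ ->] : [&& 1 - \sum_(i | P i) a i <= \prod_(i | P i) (1 - a i),
  0 <= \prod_(i | P i) (1 - a i) & \prod_(i | P i) (1 - a i) <= 1] by [].
pose K (s t : R) := [&& 1 - s <= t, 0 <= t & t <= 1].
apply: (big_rec2 K) => [|i s t Pi /and3P[h1 h2 h3]].
  by rewrite /K subr0 lexx ler01.
have /andP[a0 a1] := a01 i Pi.
by apply/and3P; split; nra.
Qed.

Lemma exp_1m_ge (n : nat) (a : R) : 0 <= a <= 1 -> 1 - n%:R * a <= (1 - a) ^+ n.
Proof.
move=> a01; have /andP[+ _] := @prod_1m_ge 'I_n predT (fun=> a) (fun _ _ => a01).
by rewrite sumr_const prodr_const card_ord mulr_natl.
Qed.

Lemma expR_le_quad (y : R) : 0 <= y <= 2^-1 -> expR y <= 1 + y + 2 * y ^+ 2.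
Proof.
move=> /andP[y0 y1].
have h : expR y * (1 - y) <= 1.
  rewrite -[leRHS](mulfV (lt0r_neq0 (expR_gt0 y))) -expRN.
  by rewrite ler_wpM2l ?expR_ge0 // -[in leLHS](opprK y) opprK expR_ge1Dx.
have := expR_gt0 y; rewrite expr2; nra.
Qed.

(* [pi] is the probability that the edge blocks its root, [Y] the old weight of
   the edge, [y1] its expected new weight and [yb] the part of [y1] carried by
   the blocking event; the first order terms of both sides agree. *)
Lemma edge_bound (r : nat) (eps tau L pi Y y1 yb : R) :
  (1 <= r)%N -> 0 <= eps <= 1 -> 0 <= L -> 0 <= tau ->
  r%:R * (eps ^+ 2 * L + 20 * tau) <= 1 ->
  0 <= pi -> pi <= eps * Y -> 0 <= Y -> Y <= tau -> 0 <= y1 ->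
  y1 * (1 - r%:R * (eps * tau)) <= Y -> pi * (1 - r%:R * (eps * L)) <= yb ->
  1 - pi + (1 + 4 * tau) * y1 - yb <=
  (1 - pi) ^+ 2 * expR ((1 + r%:R * (eps ^+ 2 * L + 20 * tau)) * Y).
Proof.
move=> r1 /andP[e0 e1] L0 t0 d1 p0 pY Y0 Yt y0 hy hb.
set d := r%:R * _ in d1 *; set rr : R := r%:R in d hy hb d1 *.
have rr1 : 1 <= rr by rewrite ler1n.
have dE : d = rr * (eps ^+ 2 * L) + 20 * (rr * tau) by rewrite /d; ring.
have rt : 20 * (rr * tau) <= 1.
  have : 0 <= rr * (eps ^+ 2 * L) by rewrite !mulr_ge0 ?sqr_ge0 //; lra.
  by move: d1; rewrite dE; lra.
have tle : tau <= rr * tau by rewrite ler_peMl.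
set a := rr * (eps * tau) in hy.
have a0 : 0 <= a by rewrite /a !mulr_ge0 //; lra.
have ale : a <= rr * tau.
  by rewrite /a ler_wpM2l ?ler_piMl //; lra.
have y1le : y1 <= Y * (1 + 2 * a).
  have h1 : 1 <= (1 - a) * (1 + 2 * a) by nra.
  have : y1 * 1 <= y1 * ((1 - a) * (1 + 2 * a)) by rewrite ler_wpM2l.
  have : y1 * (1 - a) * (1 + 2 * a) <= Y * (1 + 2 * a) by rewrite ler_wpM2r //; lra.
  by rewrite mulrA; lra.
have H1 : (1 + 4 * tau) * y1 <= Y * (1 + 8 * (rr * tau)).
  have : (1 + 4 * tau) * y1 <= (1 + 4 * tau) * (Y * (1 + 2 * a)) by rewrite ler_wpM2l //; lra.
  move=> /le_trans; apply.
  rewrite mulrCA ler_wpM2l //.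
  have : tau * a <= tau * 20^-1 by rewrite ler_wpM2l //; lra.
  lra.
have H2 : pi - Y * (rr * (eps ^+ 2 * L)) <= yb.
  apply: le_trans hb.
  have : pi * (rr * (eps * L)) <= eps * Y * (rr * (eps * L)).
    by rewrite ler_wpM2r // !mulr_ge0 //; lra.
  by rewrite expr2; nra.
have H3 : pi * Y <= tau * Y.
  have : pi * Y <= eps * Y * Y by rewrite ler_wpM2r.
  have : eps * Y * Y <= 1 * tau * Y.
    by rewrite ler_wpM2r // ler_pM.
  lra.
have d0 : 0 <= d by rewrite dE addr_ge0 // !mulr_ge0 ?sqr_ge0 //; lra.
have HE : 1 + (1 + d) * Y <= expR ((1 + d) * Y) by exact: expR_ge1Dx.
have HP : 1 - 2 * pi <= (1 - pi) ^+ 2 by rewrite expr2; nra.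
(* The case [2 * pi > 1] is void, since [pi <= Y <= tau <= 1/20]. *)
have [p2|p2] := leP (2 * pi) 1; last first.
  have := mulr_ge0 p0 Y0; have : pi <= 1 * Y by apply: le_trans pY _; rewrite ler_wpM2r.
  lra.
(* Relative to [Y], the errors are [8 r tau] (from [H1]), [r eps^2 L] (from [H2]) and [4 tau] from
   the cross term [2 pi (1 + d) Y] (by [H3] and [d <= 1]); [d] is at least their sum. *)
have : (1 - 2 * pi) * (1 + (1 + d) * Y) <= (1 - pi) ^+ 2 * expR ((1 + d) * Y).
  by apply: ler_pM => //; [lra|rewrite addr_ge0 // mulr_ge0 //; lra].
apply: le_trans.
have : d * (pi * Y) <= 1 * (pi * Y) by rewrite ler_wpM2r // mulr_ge0.
have : tau * Y <= (rr * tau) * Y by rewrite ler_wpM2r.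
have : d * Y = Y * (rr * (eps ^+ 2 * L)) + 20 * ((rr * tau) * Y) by rewrite dE; ring.
have := mulr_ge0 (mulr_ge0 (le_trans ler01 rr1) t0) Y0.
move: H1 H2 H3; rewrite !mulrDr !mulrDl; lra.
Qed.

End RealBounds.

(** * The combinatorics of one round *)

Lemma prod_natr_bool (R : comPzSemiRingType) (I : finType) (P b : pred I) :
  \prod_(i | P i) (b i)%:R = [forall (i | P i), b i]%:R :> R.
Proof.
have [/forall_inP h|] := boolP [forall (i | P i), b i].
  by rewrite big1 // => i /h ->.
rewrite negb_forall => /existsP[i]; rewrite negb_imply => /andP[Pi /negPf bi].
by rewrite (bigD1 i) //= bi mul0r.
Qed.

(* [I] is the set of vertices already picked and [O] the set of open ones; the
   remaining vertices are dead. The value of [v] is the conditional probability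
   that [v] is eventually picked. *)
Definition value (R : pzSemiRingType) (T : finType) (I O : {set T}) (x : T -> R)
    (v : T) : R :=
  if v \in I then 1 else if v \in O then x v else 0.

Definition link_weight (R : pzSemiRingType) (T : finType) (E : {set {set T}})
    (y : T -> R) (u : T) : R :=
  \sum_(e in E | u \in e) \prod_(v in e :\ u) y v.

(* The coins [C] of the open vertices decide which of them try to enter [I]; [e]
   blocks [u] when all its other vertices are in [I] or try to enter. *)
Definition hit (T : finType) (I O C : {set T}) : {set T} := I :|: (C :&: O).

Definition blocked (T : finType) (I O : {set T}) (F : {set {set T}})
    (C : {set T}) (u : T) : bool :=
  [exists e in F, (u \in e) && (e :\ u \subset hit I O C)].

Definition nbhd (T : finType) (F : {set {set T}}) (u : T) : {set T} :=
  \bigcup_(e in F | u \in e) (e :\ u).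

(** Blocking is tested against all attempts, even those that fail themselves. This makes survival a
    product over edges of events on coins, and prevents the picked set from completing an edge: each
    newly picked vertex of that edge would be blocked by it. *)
Definition next_picked (T : finType) (E : {set {set T}}) (I O C : {set T}) :=
  I :|: [set v in O | (v \in C) && ~~ blocked I O E C v].

Definition next_open (T : finType) (E : {set {set T}}) (I O C : {set T}) :=
  [set v in O | (v \notin C) && ~~ blocked I O E C v].

Lemma hitE (T : finType) (I O C : {set T}) v :
  (v \in hit I O C) = (v \in I) || (v \in C) && (v \in O).
Proof. by rewrite !inE. Qed.

Lemma sub_hitE (R : comPzSemiRingType) (T : finType) (I O C A : {set T}) :
  (A \subset hit I O C)%:R = \prod_(v in A) (v \in hit I O C)%:R :> R.
Proof.
by rewrite prod_natr_bool; congr (_%:R); congr nat_of_bool;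
  apply/fintype.subsetP/forall_inP.
Qed.

Lemma unblockedE (R : comPzRingType) (T : finType) (I O : {set T})
    (F : {set {set T}}) (C : {set T}) u :
  (~~ blocked I O F C u)%:R =
  \prod_(e in F | u \in e) (1 - (e :\ u \subset hit I O C)%:R) :> R.
Proof.
rewrite (eq_bigr (fun e => (~~ (e :\ u \subset hit I O C))%:R)); last first.
  by move=> e _; case: (_ \subset _); rewrite ?subrr ?subr0.
rewrite prod_natr_bool; congr (_%:R); congr nat_of_bool.
rewrite /blocked negb_exists; apply: eq_forallb => e.
by rewrite !negb_and; case: (e \in F); case: (u \in e).
Qed.

Lemma depends_on_hit (T : finType) (I O : {set T}) v :
  depends_on (fun C => v \in hit I O C) [set v].
Proof. by move=> C; rewrite !hitE !inE eqxx andbT. Qed.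

Lemma depends_on_sub_hit (T : finType) (I O A : {set T}) :
  depends_on (fun C => A \subset hit I O C) A.
Proof.
by move=> C; apply/fintype.subsetP/fintype.subsetP => h v vA; have := h v vA;
  rewrite !hitE !inE vA andbT.
Qed.

Lemma depends_on_blocked (T : finType) (I O : {set T}) (F : {set {set T}}) u :
  depends_on (fun C => blocked I O F C u) (nbhd F u).
Proof.
move=> C; apply: eq_existsb => e.
have [eF|//] := boolP (e \in F); have [ue|//] := boolP (u \in e).
apply: (depends_onS _ (@depends_on_sub_hit T I O (e :\ u))).
by apply: (finset.bigcup_sup e); rewrite eF.
Qed.

Lemma depends_on_comp (T : finType) (U V : Type) (h : U -> V) (f : {set T} -> U)
    (A : {set T}) : depends_on f A -> depends_on (fun C => h (f C)) A.
Proof. by move=> fA C; rewrite fA. Qed.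

(** * The effect of one round in expectation *)

Section Nibble.
Context (R : realType) (T : finType) (E : {set {set T}}) (I O : {set T}).
Context (x : T -> R) (eps tau L : R) (r : nat).
Hypotheses (unifE : uniform r.+1 E) (uncE : uncrowded E) (r1 : (1 <= r)%N).
Hypotheses (dIO : [disjoint I & O]).
Hypotheses (freeO : forall u e, u \in O -> e \in E -> u \in e -> ~~ (e :\ u \subset I)).
Hypotheses (x_bnd : forall v, v \in O -> 0 < x v <= tau).
Hypotheses (w_bnd : forall v, v \in O -> link_weight E (value I O x) v <= L).
Hypotheses (eps01 : 0 < eps <= 1) (tau0 : 0 <= tau) (L0 : 0 <= L).
Hypotheses (epsL : eps * L <= 2^-1)
  (small : r%:R * (eps ^+ 2 * L + 20 * tau) <= 1).

Let p v : R := if v \in O then eps * x v else 0.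
Let X := value I O x.
(** [Z v] is the probability that [v] is hit ([expect_hit]), and for [F \subset E], [Q F u] is the
    probability that no edge of [F] blocks [u] ([expect_unblocked]). *)
Let Z := value I O (fun v => eps * x v).
Let Q (F : {set {set T}}) u : R := \prod_(e in F | u \in e) (1 - \prod_(v in e :\ u) Z v).
(* The division by [Q E v] compensates for the probability that [v] gets
   blocked, which makes the value of [v] essentially a martingale. *)
Let x' v : R := (1 - eps) * x v / Q E v.

Lemma nibble_tau_small : 20 * tau <= 1.
Proof.
have /andP[e0 e1] := eps01.
have rr1 : 1 <= r%:R :> R by rewrite ler1n.
have : 1 * (20 * tau) <= r%:R * (eps ^+ 2 * L + 20 * tau).
  by apply: ler_pM => //; rewrite ?mulr_ge0 // lerDr mulr_ge0 ?sqr_ge0.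
by rewrite mul1r => /le_trans; apply.
Qed.

Lemma open_notin_picked v : v \in O -> (v \in I) = false.
Proof. by move=> vO; rewrite (disjointFl dIO vO). Qed.

Lemma coin01 v : 0 <= p v <= 1.
Proof.
rewrite /p; case: ifPn => [vO|_]; last by rewrite lexx ler01.
have /andP[x0 xt] := x_bnd vO; have /andP[e0 e1] := eps01.
have t1 := nibble_tau_small.
apply/andP; split; first by rewrite mulr_ge0 // ltW.
have : eps * x v <= 1 * x v by rewrite ler_wpM2r // ltW.
lra.
Qed.

Lemma value01 v : 0 <= X v <= 1.
Proof.
rewrite /X /value; case: ifP => _; first by rewrite ler01 lexx.
case: ifPn => [vO|_]; last by rewrite lexx ler01.
by have /andP[x0 xt] := x_bnd vO; have := nibble_tau_small; move=> ?; apply/andP; split; lra.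
Qed.

Lemma coin_value_ge0 v : 0 <= Z v.
Proof.
rewrite /Z /value; case: ifP => _; first exact: ler01.
case: ifPn => [vO|_ //]; have /andP[x0 xt] := x_bnd vO; have /andP[e0 e1] := eps01.
by rewrite mulr_ge0 // ltW.
Qed.

Lemma coin_value_le v : Z v <= X v.
Proof.
rewrite /Z /X /value; case: ifP => // _; case: ifPn => // vO.
have /andP[x0 xt] := x_bnd vO; have /andP[e0 e1] := eps01.
by rewrite ler_piMl // ltW.
Qed.

Lemma prod_value01 (A : {set T}) : 0 <= \prod_(v in A) X v <= 1.
Proof.
rewrite prodr_ge0 /=; last by move=> v _; have /andP[] := value01 v.
by apply: prodr_ile1 => v _; exact: value01.
Qed.

Lemma prod_coin_value_bnd (A : {set T}) : 0 <= \prod_(v in A) Z v <= \prod_(v in A) X v.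
Proof.
rewrite prodr_ge0 /=; last by move=> v _; exact: coin_value_ge0.
by apply: ler_prod => v _; rewrite coin_value_ge0 coin_value_le.
Qed.

Lemma prod_coin_value01 (A : {set T}) : 0 <= \prod_(v in A) Z v <= 1.
Proof.
have /andP[-> h] := prod_coin_value_bnd A; have /andP[_ h'] := prod_value01 A.
exact: le_trans h'.
Qed.

(** By [freeO] the link contains a vertex outside [I]; its factor alone supplies both the [eps] and
    the [tau]. *)
Lemma link_open u e : u \in O -> e \in E -> u \in e ->
  \prod_(v in e :\ u) Z v <= eps * \prod_(v in e :\ u) X v /\
  \prod_(v in e :\ u) X v <= tau.
Proof.
move=> uO eE ue; have /andP[e0 e1] := eps01.
have /fintype.subsetPn[v ve vI] := freeO uO eE ue.
rewrite (bigD1 v) //= [\prod_(v in e :\ u) X v](bigD1 v) //=.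
set a := \prod_(i in _ | _) Z i; set b := \prod_(i in _ | _) X i.
have ab : 0 <= a <= b.
  rewrite prodr_ge0 /=; last by move=> w _; exact: coin_value_ge0.
  by apply: ler_prod => w _; rewrite coin_value_ge0 coin_value_le.
have b1 : b <= 1 by apply: prodr_ile1 => w _; exact: value01.
have /andP[a0 ab'] := ab.
rewrite /Z /X /value (negPf vI); case: ifPn => [vO|_].
  have /andP[x0 xt] := x_bnd vO; split.
    by rewrite -mulrA ler_wpM2l ?ler_wpM2l // ltW.
  by rewrite -[tau]mulr1; apply: ler_pM; [exact: ltW|exact: le_trans ab'| |].
by rewrite !mul0r mulr0.
Qed.

Lemma nbhdP (F : {set {set T}}) (u v : T) :
  reflect (exists e, [/\ e \in F, u \in e, v \in e & v != u]) (v \in nbhd F u).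
Proof.
apply: (iffP finset.bigcupP) => [[e /andP[eF ue]]|[e [eF ue ve vu]]].
  by rewrite !inE => /andP[vu ve]; exists e.
by exists e; rewrite ?eF // !inE vu.
Qed.

Lemma nbhd_notin (F : {set {set T}}) u : u \notin nbhd F u.
Proof. by apply/nbhdP => -[e []]; rewrite eqxx. Qed.

Lemma expect_hit v : expect p (fun C => (v \in hit I O C)%:R) = Z v.
Proof.
rewrite /Z /value; case: ifPn => vI.
  rewrite -[RHS](expect_cst p); apply: eq_expect => C.
  by rewrite hitE vI.
case: ifPn => vO; last first.
  rewrite -[RHS](expect_cst p); apply: eq_expect => C.
  by rewrite hitE (negPf vI) (negPf vO) andbF.
transitivity (p v); last by rewrite /p vO.
rewrite -(expect_mem p); apply: eq_expect => C.
by rewrite hitE (negPf vI) vO andbT.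
Qed.

Lemma expect_sub_hit (A : {set T}) :
  expect p (fun C => (A \subset hit I O C)%:R) = \prod_(v in A) Z v.
Proof.
under eq_expect do rewrite sub_hitE.
rewrite (@expect_prod _ _ p _ _ _ (fun v => [set v])).
- by apply: eq_bigr => v _; exact: expect_hit.
- by move=> v _; apply: (depends_on_comp (fun b : bool => b%:R)); exact: depends_on_hit.
- by move=> v w _ _ vw; rewrite finset.disjoints1 inE.
Qed.

(** Without 2-cycles the sets [e :\ u] are pairwise disjoint, so the edges at [u] block it
    independently. *)
Lemma expect_unblocked (F : {set {set T}}) u : F \subset E ->
  expect p (fun C => (~~ blocked I O F C u)%:R) = Q F u.
Proof.
move=> FE; under eq_expect do rewrite unblockedE.
rewrite (@expect_prod _ _ p _ _ _ (fun e : {set T} => e :\ u)).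
- apply: eq_bigr => e _; rewrite expectD expectN expect_cst.
  by rewrite expect_sub_hit.
- move=> e _; apply: (depends_on_comp (fun b : bool => 1 - b%:R)).
  exact: depends_on_sub_hit.
move=> e f /andP[eF ue] /andP[fF uf] ef.
apply/pred0P => v /=; apply: contra_neqF ef; rewrite !inE.
move=> /andP[/andP[vu ve] /andP[_ vf]].
by apply: (uncrowded2 uncE (a := u) (b := v)); rewrite ?(fintype.subsetP FE) // eq_sym.
Qed.

Lemma unblocked_prob01 F u : 0 <= Q F u <= 1.
Proof.
rewrite /Q prodr_ge0 => [/=|e _]; last by rewrite subr_ge0; case/andP: (prod_coin_value01 (e :\ u)).
apply: prodr_ile1 => e _; have /andP[? ?] := prod_coin_value01 (e :\ u).
by rewrite subr_ge0 gerBl; apply/andP.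
Qed.

(** Union bound: the blocking probabilities add up to at most [eps] times the link weight. *)
Lemma unblocked_prob_ge u : u \in O -> 1 - eps * L <= Q E u.
Proof.
move=> uO; have /andP[e0 e1] := eps01.
have /andP[+ _] := @prod_1m_ge R _ (fun e => (e \in E) && (u \in e))
  (fun e => \prod_(v in e :\ u) Z v) (fun e _ => prod_coin_value01 (e :\ u)).
apply: le_trans; rewrite lerB //.
apply: le_trans (_ : eps * link_weight E X u <= _); last first.
  by rewrite ler_wpM2l ?w_bnd // ltW.
rewrite /link_weight big_distrr; apply: ler_sum => e /andP[eE ue].
by have [] := link_open uO eE ue.
Qed.

Lemma unblocked_prob_ge_half u : u \in O -> 2^-1 <= Q E u.
Proof. by move=> /unblocked_prob_ge; have := epsL; lra. Qed.

Lemma unblocked_prob_D1 e v : e \in E -> v \in e ->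
  Q E v = Q (E :\ e) v * (1 - \prod_(w in e :\ v) Z w).
Proof.
move=> eE ve; rewrite mulrC /Q (bigD1 e) ?eE //=; congr (_ * _).
by apply: eq_bigl => f; rewrite !inE; case: (f == e); rewrite ?andbF ?andbT.
Qed.

Lemma next_x_bnd v : v \in O -> 0 <= x' v <= 2 * tau.
Proof.
move=> vO; have /andP[e0 e1] := eps01; have /andP[x0 xt] := x_bnd vO.
have Qh := unblocked_prob_ge_half vO.
have Q0 : 0 < Q E v by apply: lt_le_trans Qh; rewrite invr_gt0.
have ex : 0 <= (1 - eps) * x v <= tau.
  apply/andP; split; first by apply: mulr_ge0; [rewrite subr_ge0|exact: ltW].
  by apply: le_trans xt; apply: ler_piMl; [exact: ltW|rewrite gerBl ltW].
rewrite /x' divr_ge0 /= ?(ltW Q0) //; last by case/andP: ex.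
case/andP: ex => _ h; rewrite ler_pdivrMr //; apply: le_trans h _.
by rewrite mulrAC ler_peMl //; lra.
Qed.

(* The new value of [v] when blocking by [e] is ignored. For [v] in [e :\ u] this
   is the true new value as soon as [u] stays open, and it only involves the
   coins of edges that meet [e] in [v], whence the independence below. *)
Let Xt (e : {set T}) v (C : {set T}) : R :=
  if v \in I then 1 else if v \in O
  then (~~ blocked I O (E :\ e) C v)%:R * (if v \in C then 1 else x' v) else 0.

Lemma depends_on_edge_value e v : depends_on (Xt e v) (v |: nbhd (E :\ e) v).
Proof.
move=> C; rewrite /Xt; case: ifP => // _; case: ifP => // _.
rewrite -(depends_onS _ (@depends_on_blocked T I O (E :\ e) v)) ?finset.subsetUr //.
by rewrite !inE eqxx andbT.
Qed.

Lemma edge_value01 e v C : 0 <= Xt e v C <= 1.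
Proof.
rewrite /Xt; case: ifP => _; first by rewrite ler01 lexx.
case: ifPn => [vO|_]; last by rewrite ler01 lexx.
have /andP[a b] := next_x_bnd vO; have := nibble_tau_small.
by case: blocked; case: ifP => _; rewrite ?(mul0r, mul1r) ?lexx ?ler01 //= => ?;
  apply/andP; split; lra.
Qed.

(* The only place where cycles of length 3 and 4 have to be excluded. *)
Lemma edge_value_disjoint u e e' v v' : e \in E -> e' \in E -> u \in e -> u \in e' ->
  v \in e :\ u -> v' \in e' :\ u -> (e, v) != (e', v') ->
  [disjoint v |: nbhd (E :\ e) v & v' |: nbhd (E :\ e') v'].
Proof.
move=> eE e'E ue ue'; rewrite !inE => /andP[vu ve] /andP[v'u v'e'] ne.
have uv : u != v by rewrite eq_sym.
have uv' : u != v' by rewrite eq_sym.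
apply/pred0P => z /=; apply: contraNF ne => /andP[].
have [ee'|ee'] := eqVneq e e'.
  (* Two vertices of one edge: a common coin would give a 2-cycle or a triangle through [v] and
     [v']. *)
  subst e'; have [->|vv'] := eqVneq v v'; first by rewrite eqxx.
  have v'v : v' != v by rewrite eq_sym.
  rewrite !in_setU1; case: eqP => [->|_] /=.
    move=> _; rewrite (negPf vv') /= => /nbhdP[f []]; rewrite !inE => /andP[fe fE] v'f vf _.
    by case/eqP: fe; apply: (uncrowded2 uncE (a := v') (b := v)).
  case/nbhdP => f []; rewrite !inE => /andP[fe fE] vf zf zv; case: eqP => [zv'|_] /=.
    by subst z; move=> _; case/eqP: fe; apply: (uncrowded2 uncE (a := v') (b := v)).
  case/nbhdP => f' []; rewrite !inE => /andP[fe' f'E] v'f' zf' zv'.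
  case/eqP: fe; apply: (uncrowded3 uncE (f := f') (a := v) (b := z) (c := v')) => //.
  by rewrite eq_sym.
(* Two edges at [u]: a common coin would close a cycle of length 2, 3 or 4 through [u]. *)
move=> zA zB; case/eqP: (ee'); move: zA zB; rewrite !in_setU1; case: eqP => [->|_] /=.
  case: eqP => [vv'|/eqP vv'] /=.
    by move=> _ _; apply: (uncrowded2 uncE (a := u) (b := v)) => //; rewrite vv'.
  move=> _ /nbhdP[f []]; rewrite !inE => /andP[fe fE] v'f vf _.
  exact: (uncrowded3 uncE (f := f) (a := u) (b := v) (c := v')).
case/nbhdP => f []; rewrite !inE => /andP[fe fE] vf zf zv; case: eqP => [zv'|_] /=.
  subst z => _.
  by apply: (uncrowded3 uncE (f := f) (a := u) (b := v) (c := v')); rewrite // eq_sym.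
case/nbhdP => f' []; rewrite !inE => /andP[fe' f'E] v'f' zf' zv'.
apply: (uncrowded4 uncE (f := f) (f' := f') (a := u) (b := v) (c := z) (b' := v')) => //.
  by rewrite eq_sym.
by rewrite eq_sym.
Qed.

(** Whether [v] is blocked does not depend on the coin of [v] itself. *)
Lemma expect_unblocked_mix (F : {set {set T}}) v (c d : R) : F \subset E ->
  expect p (fun C => (~~ blocked I O F C v)%:R * (if v \in C then c else d)) =
  Q F v * (p v * c + (1 - p v) * d).
Proof.
move=> FE; rewrite (@expectM _ _ p _ _ (nbhd F v) [set v]).
- rewrite expect_unblocked //; congr (_ * _).
  rewrite (@eq_expect _ _ p _ (fun C => (c - d) * (v \in C)%:R + d)); last first.
    by move=> C; case: (v \in C); rewrite ?mulr1 ?mulr0 ?add0r ?subrK.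
  by rewrite expectD expectZ expect_mem expect_cst; ring.
- by rewrite disjoint_sym finset.disjoints1 nbhd_notin.
- apply: (depends_on_comp (fun b : bool => (~~ b)%:R)); exact: depends_on_blocked.
- by move=> C; rewrite !inE eqxx andbT.
Qed.

(** The value is a supermartingale except for the bias caused by ignoring [e]. The probability that
    [e] does not block [v] is at least [1 - eps * tau], because [u] is an open vertex of
    [e :\ v]. *)
Lemma expect_edge_value_ub u e v : u \in O -> e \in E -> u \in e -> v \in e :\ u ->
  0 <= expect p (Xt e v) /\ expect p (Xt e v) * (1 - eps * tau) <= X v.
Proof.
move=> uO eE ue; rewrite !inE => /andP[vu ve]; have /andP[e0 e1] := eps01.
have et0 : 0 <= eps * tau <= 1.
  rewrite mulr_ge0 ?(ltW e0) //=; have := nibble_tau_small.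
  have : eps * tau <= 1 * tau by rewrite ler_wpM2r.
  lra.
split.
  rewrite -(expect_cst p 0); apply: ler_expect => [|C]; first exact: coin01.
  by case/andP: (edge_value01 e v C).
rewrite /Xt /X /value; have [vI|vI] := boolP (v \in I).
  by rewrite expect_cst; lra.
have [vO|vO] := boolP (v \in O); last by rewrite expect_cst mul0r.
rewrite expect_unblocked_mix ?finset.subD1set // mulr1.
have Qh := unblocked_prob_ge_half vO; have QE := unblocked_prob_D1 eE ve.
set a := 1 - _ in QE; set q := Q (E :\ e) v in QE *.
have /andP[q0 q1] : 0 <= q <= 1 by exact: unblocked_prob01.
have a1 : a <= 1 by rewrite gerBl; case/andP: (prod_coin_value01 (e :\ v)).
have aet : 1 - eps * tau <= a.
  rewrite lerB // (bigD1 u) ?inE 1?eq_sym ?vu //=.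
  have /andP[x0 xt] := x_bnd uO.
  rewrite {1}/Z /value open_notin_picked // uO -[leRHS]mulr1; apply: ler_pM.
  - by rewrite mulr_ge0 // ltW.
  - by apply: prodr_ge0 => w _; exact: coin_value_ge0.
  - by rewrite ler_wpM2l // ltW.
  apply: prodr_ile1 => w _; rewrite coin_value_ge0 /=.
  by apply: le_trans (coin_value_le w) _; case/andP: (value01 w).
have Q0 : 0 < q * a by rewrite -QE; apply: lt_le_trans Qh; rewrite invr_gt0.
have a0 : 0 < a by case: (ltgtP 0 a) Q0 => // ?; nra.
have q0' : 0 < q by move: Q0; rewrite pmulr_lgt0.
have /andP[x0 xt] := x_bnd vO; have /andP[pv0 pv1] := coin01 v.
rewrite /x' QE; set m := _ + _.
have m0 : 0 <= q * m.
  by rewrite mulr_ge0 // addr_ge0 ?mulr_ge0 ?invr_ge0 ?subr_ge0 ?(ltW Q0) ?(ltW x0).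
(* The factor [a] restores the survival probability [Q E v = q * a], which cancels the denominator
   of [x' v]. *)
apply: le_trans (_ : q * m * a <= _); first by rewrite ler_wpM2l.
have -> : q * m * a = q * a * p v + (1 - p v) * ((1 - eps) * x v).
  by rewrite /m; field; rewrite (gt_eqF q0') (gt_eqF a0).
have qa : q * a <= 1 by rewrite -[leRHS]mulr1 ler_pM // ltW.
have : q * a * p v <= 1 * p v by rewrite ler_wpM2r.
have : (1 - p v) * ((1 - eps) * x v) <= 1 * ((1 - eps) * x v).
  by rewrite ler_wpM2r ?mulr_ge0 ?(ltW x0) //; lra.
have pE : p v = eps * x v by rewrite /p vO.
lra.
Qed.

(** A hit open vertex has edge value 1 unless another edge blocks it, which has probability at most
    [eps * L]. This provides the bound on [yb] in [edge_bound]. *)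
Lemma expect_edge_value_hit_lb e v : e \in E -> v \in e ->
  Z v * (1 - eps * L) <= expect p (fun C => Xt e v C * (v \in hit I O C)%:R).
Proof.
move=> eE ve; have /andP[e0 e1] := eps01.
have eL : 0 <= eps * L by rewrite mulr_ge0 // ltW.
rewrite /Xt /Z /value; have [vI|vI] := boolP (v \in I).
  under eq_expect do rewrite hitE vI mulr1.
  by rewrite expect_cst; lra.
have [vO|vO] := boolP (v \in O); last first.
  by under eq_expect do rewrite mul0r; rewrite expect_cst mul0r.
rewrite (@eq_expect _ _ p _ (fun C => (~~ blocked I O (E :\ e) C v)%:R *
  (if v \in C then 1 else 0))); last first.
  move=> C; rewrite hitE (negPf vI) vO andbT -mulrA; congr (_ * _).
  by case: (v \in C); rewrite ?mulr1 ?mulr0.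
rewrite expect_unblocked_mix ?finset.subD1set // mulr0 addr0 mulr1 /p vO mulrC.
have /andP[x0 _] := x_bnd vO.
rewrite ler_wpM2r ?mulr_ge0 ?(ltW x0) ?(ltW e0) //.
apply: le_trans (unblocked_prob_ge vO) _; rewrite (unblocked_prob_D1 eE ve) ler_piMr //.
  by case/andP: (unblocked_prob01 (E :\ e) v).
by rewrite gerBl; case/andP: (prod_coin_value01 (e :\ v)).
Qed.

(** The factor of [e] in the exponential of the new link weight of [u], set to 0 when [e] blocks
    [u]. *)
Let G u e (C : {set T}) : R :=
  (~~ (e :\ u \subset hit I O C))%:R * expR (\prod_(v in e :\ u) Xt e v C).

(** If [e] does not block, some vertex of the link is not hit and has value at most [2 * tau], so
    the exponential is at most [1 + y + 2 y^2 <= 1 + (1 + 4 tau) y]. The last product corrects for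
    the blocking event, where [G] vanishes. *)
Lemma edge_factor_le u e C :
  G u e C <= 1 - (e :\ u \subset hit I O C)%:R
    + (1 + 4 * tau) * \prod_(v in e :\ u) Xt e v C
    - \prod_(v in e :\ u) (Xt e v C * (v \in hit I O C)%:R).
Proof.
rewrite /G big_split /= -sub_hitE.
set y := \prod_(v in _) Xt e v C.
have y0 : 0 <= y by apply: prodr_ge0 => v _; case/andP: (edge_value01 e v C).
have tau_s := nibble_tau_small.
have [sub|nsub] := boolP (_ \subset _).
  by rewrite /= mul0r mulr1 subrr add0r mulrDl mul1r addrAC subrr add0r !mulr_ge0.
rewrite /= mul1r mulr0 !subr0.
have yt : y <= 2 * tau.
  have /fintype.subsetPn[v vA] := nsub; rewrite hitE negb_or negb_and => /andP[vI vCO].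
  rewrite /y (bigD1 v) //= -[leRHS]mulr1; apply: ler_pM.
  - by case/andP: (edge_value01 e v C).
  - by apply: prodr_ge0 => w _; case/andP: (edge_value01 e w C).
  - rewrite /Xt (negPf vI); case: ifPn vCO => [vO|_ _]; last by rewrite mulr_ge0.
    rewrite orbF => /negPf ->; have /andP[h1 h2] := next_x_bnd vO.
    by case: blocked; rewrite ?mul0r ?mul1r ?mulr_ge0.
  - by apply: prodr_ile1 => w _; exact: edge_value01.
apply: le_trans (@expR_le_quad R y _) _; first by apply/andP; split; lra.
have : y * y <= 2 * tau * y by rewrite ler_wpM2r.
by rewrite expr2; lra.
Qed.

Let del := r%:R * (eps ^+ 2 * L + 20 * tau).

(** The non-blocking probability appears squared so that, over all edges at [u], it cancels the
    [Q E u ^+ 2] in the denominator of [x' u ^+ 2]; this is why the potential weighs [expR] by the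
    square of the value. *)
Lemma expect_edge_factor_le u e : u \in O -> e \in E -> u \in e ->
  expect p (G u e) <= (1 - \prod_(v in e :\ u) Z v) ^+ 2 *
    expR ((1 + del) * \prod_(v in e :\ u) X v).
Proof.
move=> uO eE ue; have /andP[e0 e1] := eps01.
have card_e : #|e :\ u| = r.
  by have := unifE eE; rewrite (cardsD1 u) ue => -[].
have [ZX Xtau] := link_open uO eE ue.
have et0 : 0 <= eps * tau <= 1.
  rewrite mulr_ge0 ?(ltW e0) //=; have := nibble_tau_small.
  have : eps * tau <= 1 * tau by rewrite ler_wpM2r.
  lra.
have eL0 : 0 <= eps * L <= 1.
  by rewrite mulr_ge0 ?(ltW e0) //=; have := epsL; lra.
apply: le_trans (ler_expect coin01 (edge_factor_le u e)) _.
rewrite expectD expectN expectD expectD expectN expect_cst expectZ expect_sub_hit.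
rewrite (@expect_prod _ _ p _ _ _ (fun v => v |: nbhd (E :\ e) v)); first last.
- move=> v w ve we vw; apply: (edge_value_disjoint eE eE ue ue ve we).
  by apply: contra_neq vw => -[].
- by move=> v _; exact: depends_on_edge_value.
rewrite (@expect_prod _ _ p _ _ _ (fun v => v |: nbhd (E :\ e) v)); first last.
- move=> v w ve we vw; apply: (edge_value_disjoint eE eE ue ue ve we).
  by apply: contra_neq vw => -[].
- move=> v _ C; rewrite -depends_on_edge_value; congr (_ * (nat_of_bool _)%:R).
  apply: (depends_onS _ (@depends_on_hit T I O v)).
  by rewrite finset.sub1set !inE eqxx.
apply: edge_bound => //; rewrite ?(ltW e0) ?e1 //.
- by case/andP: (prod_coin_value01 (e :\ u)).
- by case/andP: (prod_value01 (e :\ u)).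
- by apply: prodr_ge0 => v /(expect_edge_value_ub uO eE ue)[].
- have y0 : 0 <= \prod_(v in e :\ u) expect p (Xt e v).
    by apply: prodr_ge0 => v /(expect_edge_value_ub uO eE ue)[].
  apply: le_trans (ler_wpM2l y0 (exp_1m_ge r et0)) _.
  rewrite -card_e -prodr_const -big_split /=; apply: ler_prod => v ve.
  have [h1 ->] := expect_edge_value_ub uO eE ue ve; rewrite mulr_ge0 //; lra.
have /andP[pi0 _] := prod_coin_value01 (e :\ u).
apply: le_trans (ler_wpM2l pi0 (exp_1m_ge r eL0)) _.
rewrite -card_e -prodr_const -big_split /=; apply: ler_prod => v; rewrite !inE => /andP[_ ve].
rewrite expect_edge_value_hit_lb // mulr_ge0 ?coin_value_ge0 //; lra.
Qed.

(** A vertex [u] that stays open is not hit, so [e] cannot block [v]. *)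
Lemma value_next u e v C : u \in next_open E I O C -> e \in E -> u \in e ->
  v \in e :\ u ->
  value (next_picked E I O C) (next_open E I O C) x' v = Xt e v C.
Proof.
rewrite /value /Xt !inE => /and3P[uO uC _] eE ue /andP[vu ve].
have [//|vI] := boolP (v \in I); have [vO /=|//] := boolP (v \in O).
have -> : blocked I O E C v = blocked I O (E :\ e) C v.
  apply/idP/idP => /exists_inP[f fE /andP[vf sub]]; apply/exists_inP; exists f.
  - rewrite !inE fE andbT; apply: contraTneq sub => ->.
    apply/fintype.subsetPn; exists u; first by rewrite !inE eq_sym vu.
    by rewrite hitE (negPf uC) open_notin_picked.
  - by rewrite vf.
  - by move: fE; rewrite !inE => /andP[].
  - by rewrite vf.
by case: (v \in C); case: blocked; rewrite /= ?mul0r ?mul1r.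
Qed.

Lemma expect_next_weight u : u \in O ->
  expect p (fun C => (u \in next_open E I O C)%:R * (x' u ^+ 2 *
    expR (link_weight E (value (next_picked E I O C) (next_open E I O C) x') u)))
  <= x u ^+ 2 * expR (link_weight E X u) * expR (del * L).
Proof.
move=> uO; have /andP[e0 e1] := eps01; have /andP[x0 xt] := x_bnd uO.
have Qh := unblocked_prob_ge_half uO.
have Q0 : 0 < Q E u by apply: lt_le_trans Qh; rewrite invr_gt0.
have GE C : (u \in next_open E I O C)%:R * (x' u ^+ 2 *
    expR (link_weight E (value (next_picked E I O C) (next_open E I O C) x') u))
    <= x' u ^+ 2 * \prod_(e in E | u \in e) G u e C.
  have P0 : 0 <= \prod_(e in E | u \in e) G u e C.
    by apply: prodr_ge0 => e _; rewrite mulr_ge0 ?expR_ge0.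
  have [uO'|_] := boolP (u \in next_open E I O C); last first.
    by rewrite mul0r mulr_ge0 ?sqr_ge0.
  rewrite mul1r ler_wpM2l ?sqr_ge0 // /link_weight expR_sum.
  rewrite le_eqVlt; apply/orP; left; apply/eqP; apply: eq_bigr => e /andP[eE ue].
  rewrite /G; have -> : (e :\ u \subset hit I O C) = false.
    move: uO'; rewrite inE => /and3P[_ _]; apply: contraNF => sub.
    by apply/exists_inP; exists e; rewrite ?ue.
  by rewrite mul1r; congr (expR _); apply: eq_bigr => v ve; exact: (value_next uO' eE ue ve).
apply: le_trans (ler_expect coin01 GE) _; rewrite expectZ.
(* The factors of distinct edges at [u] use disjoint sets of coins, by [edge_value_disjoint]. *)
rewrite (@expect_prod _ _ p _ _ _ (fun e : {set T} =>
  \bigcup_(v in e :\ u) (v |: nbhd (E :\ e) v))); first last.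
- move=> e e' /andP[eE ue] /andP[e'E ue'] ee'.
  rewrite finset.disjoints_subset; apply/finset.bigcupsP => v ve.
  rewrite -finset.disjoints_subset disjoint_sym finset.disjoints_subset.
  apply/finset.bigcupsP => v' ve'; rewrite -finset.disjoints_subset disjoint_sym.
  apply: (edge_value_disjoint eE e'E ue ue' ve ve').
  by apply: contra_neq ee' => -[].
- move=> e _ C; rewrite /G; congr ((nat_of_bool (~~ _))%:R * expR _).
    apply: (depends_onS _ (@depends_on_sub_hit T I O (e :\ u))).
    apply/fintype.subsetP => v ve; apply/finset.bigcupP; exists v => //.
    by rewrite !inE eqxx.
  apply: eq_bigr => v ve; apply: (depends_onS _ (@depends_on_edge_value e v)).
  exact: (finset.bigcup_sup v).
have GQ : \prod_(e in E | u \in e) expect p (G u e) <=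
    Q E u ^+ 2 * expR ((1 + del) * link_weight E X u).
  rewrite /link_weight big_distrr expR_sum /Q -prodrXl -big_split /=.
  apply: ler_prod => e /andP[eE ue]; rewrite expect_edge_factor_le // andbT.
  rewrite -(expect_cst p 0); apply: ler_expect => [|C]; first exact: coin01.
  by rewrite mulr_ge0 ?expR_ge0.
apply: le_trans (ler_wpM2l (sqr_ge0 _) GQ) _.
rewrite mulrA -exprMn /x' divfK ?gt_eqF // [(1 + del) * _]mulrDl mul1r expRD mulrA.
have d0 : 0 <= del.
  by apply: mulr_ge0 => //; apply: addr_ge0; apply: mulr_ge0 => //; exact: sqr_ge0.
apply: ler_pM.
- by apply: mulr_ge0; [exact: sqr_ge0|exact: expR_ge0].
- exact: expR_ge0.
- rewrite ler_wpM2r ?expR_ge0 // ler_sqr ?nnegrE ?mulr_ge0 ?subr_ge0 ?(ltW x0) //.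
  by rewrite ler_piMl ?(ltW x0) // gerBl ltW.
- by rewrite ler_expR ler_wpM2l ?w_bnd.
Qed.

Lemma expect_next_picked :
  #|I|%:R + eps * (1 - eps * L) * \sum_(v in O) x v <=
  expect p (fun C => #|next_picked E I O C|%:R).
Proof.
have /andP[e0 e1] := eps01.
rewrite (@eq_expect _ _ p _ (fun C => #|I|%:R + \sum_(v in O)
  (~~ blocked I O E C v)%:R * (if v \in C then 1 else 0))); last first.
  move=> C; rewrite cardsU (_ : _ :&: _ = finset.set0) ?cards0 ?subn0; last first.
    apply/finset.setP => v; rewrite !inE; apply/negbTE/negP => /and3P[vI vO _].
    by rewrite open_notin_picked in vI.
  rewrite natrD; congr (_ + _); rewrite -sum1_card natr_sum.
  rewrite [RHS](bigID (fun v => (v \in C) && ~~ blocked I O E C v)) /=.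
  rewrite [X in _ + X]big1 ?addr0; last first.
    by move=> v /andP[_]; case: (v \in C); case: blocked; rewrite /= ?mul0r ?mulr0.
  apply: eq_big => [v|v]; rewrite inE // => /and3P[_ -> ->].
  by rewrite mulr1.
rewrite expectD expect_cst lerD2l expect_sum big_distrr /=; apply: ler_sum => v vO.
rewrite expect_unblocked_mix // mulr1 mulr0 addr0 /p vO mulrAC [leRHS]mulrC.
have /andP[x0 _] := x_bnd vO.
by rewrite ler_wpM2l ?mulr_ge0 ?unblocked_prob_ge ?ltW.
Qed.

(** The survival probability cancels against [x']; what is lost is the factor [1 - eps] and the
    chance [eps * x v] that [v] tries to enter. *)
Lemma expect_next_mass :
  (1 - eps) * (1 - eps * tau) * \sum_(v in O) x v <=
  expect p (fun C => \sum_(v in next_open E I O C) x' v).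
Proof.
have /andP[e0 e1] := eps01.
rewrite (@eq_expect _ _ p _ (fun C => \sum_(v in O)
  x' v * ((~~ blocked I O E C v)%:R * (if v \in C then 0 else 1)))); last first.
  move=> C; rewrite [RHS](bigID (fun v => (v \notin C) && ~~ blocked I O E C v)) /=.
  rewrite [X in _ + X]big1 ?addr0; last first.
    by move=> v /andP[_]; case: (v \in C); case: blocked; rewrite /= ?mul0r ?mulr0.
  apply: eq_big => [v|v]; rewrite inE // => /and3P[_ /negPf -> ->].
  by rewrite !mulr1.
rewrite expect_sum big_distrr /=; apply: ler_sum => v vO.
rewrite expectZ expect_unblocked_mix // mulr1 mulr0 add0r.
have Qh := unblocked_prob_ge_half vO.
have Q0 : 0 < Q E v by apply: lt_le_trans Qh; rewrite invr_gt0.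
have /andP[x0 xt] := x_bnd vO.
rewrite /x' mulrA divfK ?gt_eqF // mulrAC ler_wpM2l ?mulr_ge0 ?subr_ge0 ?(ltW x0) //.
by rewrite lerB // /p vO ler_wpM2l // ltW.
Qed.

Lemma next_x_ge v : v \in O -> (1 - eps) * x v <= x' v.
Proof.
move=> vO; have /andP[e0 e1] := eps01; have /andP[x0 xt] := x_bnd vO.
have Qh := unblocked_prob_ge_half vO.
have Q0 : 0 < Q E v by apply: lt_le_trans Qh; rewrite invr_gt0.
rewrite /x' ler_pdivlMr // ler_piMr ?mulr_ge0 ?subr_ge0 ?(ltW x0) //.
by case/andP: (unblocked_prob01 E v).
Qed.

(** The three expectations are combined into one functional, so that a single outcome serves all of
    them. The coefficients [g] and [b] stay free because they vary with the number of remaining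
    rounds. *)
Lemma nibble_outcome (g b : R) : 0 < tau -> 0 <= g -> 0 <= b ->
  exists C y, (forall v, v \in O -> (1 - eps) * x v <= y v) /\
  let I' := next_picked E I O C in let O' := next_open E I O C in
  #|I|%:R + (eps * (1 - eps * L) + g * ((1 - eps) * (1 - eps * tau))) * \sum_(v in O) x v
    - b * expR (del * L) * \sum_(v in O) x v ^+ 2 * expR (link_weight E (value I O x) v)
  <= #|I'|%:R + g * \sum_(v in O') y v
    - b * \sum_(v in O') y v ^+ 2 * expR (link_weight E (value I' O' y) v).
Proof.
move=> t0 g0 b0.
pose lhs := #|I|%:R
  + (eps * (1 - eps * L) + g * ((1 - eps) * (1 - eps * tau))) * \sum_(v in O) x v
  - b * expR (del * L) * \sum_(v in O) x v ^+ 2 * expR (link_weight E X v).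
pose rhs C := let I' := next_picked E I O C in let O' := next_open E I O C in
  #|I'|%:R + g * \sum_(v in O') x' v
    - b * \sum_(v in O') x' v ^+ 2 * expR (link_weight E (value I' O' x') v).
suff /(expect_exists coin01)[C hC] : lhs <= expect p rhs.
  by exists C, x'; split=> // v; exact: next_x_ge.
rewrite /lhs /rhs {lhs rhs}.
rewrite expectD expectN expectD !expectZ mulrDl addrA -(mulrA g); apply: lerB.
  by apply: lerD; [exact: expect_next_picked|rewrite ler_wpM2l ?expect_next_mass].
rewrite -mulrA ler_wpM2l //.
rewrite (@eq_expect _ _ p _ (fun C => \sum_(v in O) (v \in next_open E I O C)%:R *
  (x' v ^+ 2 *
  expR (link_weight E (value (next_picked E I O C) (next_open E I O C) x') v)))); last first.
  move=> C; rewrite [RHS](bigID (fun v => v \in next_open E I O C)) /=.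
  rewrite [X in _ + X]big1 ?addr0; last by move=> v /andP[_ /negPf ->]; rewrite mul0r.
  apply: eq_big => [v|v ->]; last by rewrite mul1r.
  by rewrite inE; case: (v \in O).
rewrite expect_sum big_distrr /=; apply: ler_sum => v vO.
by rewrite [leRHS]mulrC expect_next_weight.
Qed.

End Nibble.

(* In the last sum, [x v * expR (link_weight v)] is nearly invariant along the
   process for a surviving vertex. A vertex for which it exceeds [1 / b] can be
   discarded without decreasing the potential, provided [g <= 1]. *)
Definition potential (R : realType) (T : finType) (E : {set {set T}}) (g b : R)
    (I O : {set T}) (x : T -> R) : R :=
  #|I|%:R + g * \sum_(v in O) x v
  - b * \sum_(v in O) x v ^+ 2 * expR (link_weight E (value I O x) v).

(** For [xm > 0] the last clause gives [x v <= tau]; with [tau <= expR L * xm], the last two bound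
    the link weights of open vertices by [L]. *)
Definition nibble_state (R : realType) (T : finType) (E : {set {set T}})
    (tau xm : R) (I O : {set T}) (x : T -> R) : Prop :=
  [/\ [disjoint I & O], independent E I,
      forall u e, u \in O -> e \in E -> u \in e -> ~~ (e :\ u \subset I),
      forall v, v \in O -> xm <= x v
    & forall v, v \in O -> x v * expR (link_weight E (value I O x) v) <= tau].

(* Expected fraction of the open mass which is picked within [k] rounds. *)
Fixpoint gain (R : pzRingType) (eps L tau : R) (k : nat) : R :=
  if k is k'.+1
  then eps * (1 - eps * L) + gain eps L tau k' * ((1 - eps) * (1 - eps * tau))
  else 0.

(** * Iterating the rounds *)

Section Iteration.
Context (R : realType) (T : finType) (E : {set {set T}}).
Context (eps tau L : R) (r : nat).
Hypotheses (unifE : uniform r.+1 E) (uncE : uncrowded E) (r1 : (1 <= r)%N).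
Hypotheses (eps01 : 0 < eps < 1) (tau0 : 0 < tau) (L0 : 0 <= L).
Hypotheses (epsL : eps * L <= 2^-1)
  (small : r%:R * (eps ^+ 2 * L + 20 * tau) <= 1).

Let del := r%:R * (eps ^+ 2 * L + 20 * tau).

Lemma link_weight_ge0 (y : T -> R) u : (forall v, 0 <= y v) -> 0 <= link_weight E y u.
Proof. by move=> y0; apply: sumr_ge0 => e _; apply: prodr_ge0. Qed.

Lemma value_ge0 (I O : {set T}) (x : T -> R) v :
  (forall u, u \in O -> 0 <= x u) -> 0 <= value I O x v.
Proof.
move=> x0; rewrite /value; case: ifP => _; first exact: ler01.
by case: ifPn => // vO; exact: x0.
Qed.

Lemma link_weight_discard (I O O' : {set T}) (x : T -> R) u : O' \subset O ->
  (forall v, v \in O -> 0 <= x v) ->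
  link_weight E (value I O' x) u <= link_weight E (value I O x) u.
Proof.
move=> sub x0; apply: ler_sum => e _; apply: ler_prod => v _.
rewrite value_ge0 => [/=|w /(fintype.subsetP sub)]; last exact: x0.
rewrite /value; case: ifP => // _; case: ifPn => [vO'|_].
  by rewrite (fintype.subsetP sub).
by case: ifPn => // /x0.
Qed.

Lemma nibble_step (g b xm : R) (I O : {set T}) (x : T -> R) :
  nibble_state E tau xm I O x -> 0 < xm -> tau <= expR L * xm ->
  0 <= g <= 1 -> 1 <= b * tau ->
  exists I' O' x', nibble_state E tau (xm * (1 - eps)) I' O' x' /\
    potential E (eps * (1 - eps * L) + g * ((1 - eps) * (1 - eps * tau)))
      (b * expR (del * L)) I O x <= potential E g b I' O' x'.
Proof.
move=> [dIO indI freeO xmO xwO] xm0 tauL /andP[g0 g1] bt.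
have /andP[e0 e1] := eps01.
have b0 : 0 <= b by rewrite -(pmulr_lge0 _ tau0); apply: le_trans bt.
have x0 v : v \in O -> 0 < x v by move=> /xmO; exact: lt_le_trans.
have X0 v : 0 <= value I O x v by apply: value_ge0 => u /x0/ltW.
have x_bnd v : v \in O -> 0 < x v <= tau.
  move=> vO; rewrite x0 //=; apply: le_trans (xwO v vO).
  by rewrite ler_peMr ?(ltW (x0 v vO)) // -expR0 ler_expR link_weight_ge0.
have w_bnd v : v \in O -> link_weight E (value I O x) v <= L.
  move=> vO; rewrite -ler_expR -(ler_pM2l xm0); apply: le_trans (_ : tau <= _).
    by apply: le_trans (xwO v vO); rewrite ler_wpM2r ?expR_ge0 ?xmO.
  by rewrite mulrC.
have eps01' : 0 < eps <= 1 by rewrite e0 ltW.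
have [C [x' [next_x_ge hC]]] := nibble_outcome unifE uncE r1 dIO freeO x_bnd w_bnd eps01' (ltW tau0)
  L0 epsL small tau0 g0 b0.
move: hC => /=.
set I' := next_picked E I O C; set O' := next_open E I O C.
have O'O v : v \in O' -> v \in O by rewrite inE => /and3P[].
have x'ge v : v \in O -> xm * (1 - eps) <= x' v.
  move=> vO; apply: le_trans (next_x_ge v vO).
  by rewrite mulrC ler_wpM2l ?xmO // subr_ge0 ltW.
have x'0 v : v \in O -> 0 < x' v.
  by move=> /x'ge; apply: lt_le_trans; rewrite mulr_gt0 // subr_gt0.
pose w v := link_weight E (value I' O' x') v.
(* Vertices that violate the last clause of [nibble_state] are discarded; this only lowers the link
   weights of the others. *)
pose O'' := [set v in O' | x' v * expR (w v) <= tau].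
have sO'' : O'' \subset O' by apply/fintype.subsetP => v; rewrite inE => /andP[].
have w_le v : link_weight E (value I' O'' x') v <= w v.
  by apply: link_weight_discard => // u /O'O/x'0/ltW.
have hitI' : I' \subset hit I O C.
  apply/fintype.subsetP => v; rewrite hitE !inE.
  by case/orP => [->//|/and3P[-> -> _]]; rewrite orbT.
move=> hC; exists I', O'', x'; split; first split.
- apply/pred0P => v /=; apply/negbTE/negP => /andP[].
  rewrite !inE => /orP[vI|/and3P[_ vC _]]; last by rewrite vC !andbF.
  by rewrite (disjointFr dIO vI).
(* An edge inside [I'] has a vertex outside [I], hence newly picked; but all other vertices of the
   edge are hit, so it was blocked. *)
- apply/forall_inP => e eE; apply/negP => eI'.
  have /forall_inP/(_ e eE)/fintype.subsetPn[v ve vI] := indI.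
  have := fintype.subsetP eI' v ve; rewrite !inE (negPf vI) /= => /and3P[_ _ /negP[]].
  apply/exists_inP; exists e; rewrite // ve /=.
  by apply: fintype.subset_trans hitI'; apply: fintype.subset_trans eI'; exact: subD1set.
- move=> u e; rewrite !inE => /andP[/and3P[_ _ nb] _] eE ue; apply: contra nb => sub.
  by apply/exists_inP; exists e; rewrite // ue (fintype.subset_trans sub).
- by move=> v /(fintype.subsetP sO'')/O'O; exact: x'ge.
- move=> v vO''; have := vO''; rewrite inE => /andP[/O'O vO]; apply: le_trans.
  by rewrite ler_wpM2l ?ler_expR ?w_le // ltW ?x'0.
apply: le_trans hC _; rewrite /potential -!addrA lerD2l !mulr_sumr -!sumrB.
rewrite [X in X <= _](bigID (mem O'')) /= -[leRHS]addr0; apply: lerD.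
  rewrite (eq_bigl (mem O'')); last first.
    by move=> v; rewrite /= [v \in O'']inE; case: (v \in O').
  apply: ler_sum => v vO''; rewrite lerB // ler_wpM2l // ler_wpM2l ?sqr_ge0 //.
  by rewrite ler_expR w_le.
(* A discarded vertex contributes at most 0: [g x' <= x' <= b tau x' <= b x'^2 exp(w)]. *)
apply: sumr_le0 => v /andP[vO']; rewrite inE vO' /= -ltNge => tau_lt.
have x'v := x'0 v (O'O v vO'); rewrite subr_le0.
apply: le_trans (_ : 1 * x' v <= _); first by rewrite ler_wpM2r // ltW.
apply: le_trans (_ : b * tau * x' v <= _); first by rewrite ler_wpM2r // ltW.
rewrite -mulrA ler_wpM2l // expr2 -mulrA mulrC ler_wpM2l //; first exact: ltW.
exact: ltW.
Qed.

Lemma tau_le1 : tau <= 1.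
Proof.
have /andP[e0 e1] := eps01.
have : 20 * tau <= 1.
  by apply: (nibble_tau_small r1 _ (ltW tau0) L0 small); rewrite e0 ltW.
have := tau0; lra.
Qed.

Lemma gain_01 k : 0 <= gain eps L tau k <= 1.
Proof.
have /andP[e0 e1] := eps01.
have eL : 0 <= eps * L by rewrite mulr_ge0 // ltW.
have t1 := tau_le1.
have et : 0 <= eps * tau <= 1.
  rewrite mulr_ge0 ?(ltW e0) ?(ltW tau0) //= -[leRHS]mulr1.
  by apply: ler_pM => //; exact: ltW.
elim: k => [|k /andP[g0 g1]] /=; first by rewrite lexx ler01.
have /andP[et0 et1] := et.
have h0 : 0 <= (1 - eps) * (1 - eps * tau) by rewrite mulr_ge0 // subr_ge0 // ltW.
have h1 : (1 - eps) * (1 - eps * tau) <= (1 - eps) * 1.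
  by rewrite ler_wpM2l ?gerBl // subr_ge0 ltW.
apply/andP; split.
  by rewrite addr_ge0 // ?mulr_ge0 ?(ltW e0) //; have := epsL; lra.
have : gain eps L tau k * ((1 - eps) * (1 - eps * tau)) <= 1 * ((1 - eps) * (1 - eps * tau)).
  by rewrite ler_wpM2r.
have : eps * (1 - eps * L) <= eps * 1 by rewrite ler_wpM2l ?gerBl // ltW.
lra.
Qed.

(** [gain] is a geometric sum of ratio [rho = (1 - eps)(1 - eps tau)], and
    [1 - rho <= eps (1 + tau)]. *)
Lemma gain_ge k :
  (1 - eps * L) * (1 - (1 - eps) ^+ k) <= (1 + tau) * gain eps L tau k.
Proof.
have /andP[e0 e1] := eps01.
have t1 := tau_le1.
have et : eps * tau <= 1 by rewrite -[leRHS]mulr1; apply: ler_pM => //; exact: ltW.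
have et0 : 0 <= eps * tau by rewrite mulr_ge0 ?ltW.
pose rho := (1 - eps) * (1 - eps * tau).
have rho0 : 0 <= rho by rewrite mulr_ge0 // subr_ge0 // ltW.
have rho1 : rho <= 1 - eps by rewrite ler_piMr ?gerBl // subr_ge0 ltW.
have Q0 : 0 <= 1 - eps * L by have := epsL; lra.
apply: le_trans (_ : (1 - eps * L) * (1 - rho ^+ k) <= _).
  by rewrite ler_wpM2l // lerB // lerXn2r // nnegrE subr_ge0 ltW.
elim: k => [|k IHk] /=; first by rewrite expr0 subrr !mulr0.
have := ler_wpM2r rho0 IHk; rewrite exprS -/rho.
have : 1 - rho <= eps * (1 + tau).
  by rewrite /rho; have := mulr_ge0 (ltW e0) et0; lra.
move=> /(ler_wpM2l Q0); set a := rho ^+ k; set q := 1 - eps * L.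
lra.
Qed.

(** The coefficients are indexed by the number of remaining rounds. They end with [g = 0] and
    [b = 1 / tau], where the potential is at most [#|I|], and [b * tau >= 1] holds throughout, as
    discarding requires. *)
Lemma nibble_iter k (xm : R) (I O : {set T}) (x : T -> R) :
  nibble_state E tau xm I O x -> 0 < xm -> tau <= expR L * (xm * (1 - eps) ^+ k) ->
  exists2 J, independent E J &
    potential E (gain eps L tau k) (expR (del * L) ^+ k / tau) I O x <= #|J|%:R.
Proof.
have /andP[e0 e1] := eps01; have e10 : 0 < 1 - eps by rewrite subr_gt0.
elim: k xm I O x => [|k IHk] xm I O x st xm0 tk.
  case: (st) => _ indI _ _ _; exists I => //.
  rewrite /potential /= mul0r addr0 gerBl mulr_ge0 //.
    by rewrite mulr_ge0 // invr_ge0 ltW.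
  by apply: sumr_ge0 => v _; rewrite mulr_ge0 ?sqr_ge0 ?expR_ge0.
have del0 : 0 <= del * L.
  rewrite mulr_ge0 // mulr_ge0 // addr_ge0 // mulr_ge0 ?sqr_ge0 // ltW //.
have b1 : 1 <= expR (del * L) ^+ k by rewrite exprn_ege1 // -expR0 ler_expR.
have bt : 1 <= expR (del * L) ^+ k / tau * tau by rewrite divfK // gt_eqF.
have tL : tau <= expR L * xm.
  apply: le_trans tk _; rewrite ler_wpM2l ?expR_ge0 // ler_piMr ?(ltW xm0) //.
  by rewrite exprn_ile1 ?(ltW e10) // gerBl ltW.
have [I1 [U [y [st' le']]]] := nibble_step st xm0 tL (gain_01 k) bt.
have xm'0 : 0 < xm * (1 - eps) by rewrite mulr_gt0.
have [|J indJ leJ] := IHk _ _ _ _ st' xm'0; first by rewrite -mulrA -exprS.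
exists J => //; apply: le_trans leJ; apply: le_trans le'.
by rewrite /= [_ ^+ k.+1]exprSr [_ * _ / tau]mulrAC.
Qed.

Lemma nibble_from_uniform (k : nat) (S : {set T}) (x0 D : R) : 0 < x0 ->
  (forall v, v \in S -> #|[set e in E | (v \in e) && (e \subset S)]|%:R <= D) ->
  x0 * expR (D * x0 ^+ r) <= tau -> tau <= expR L * (x0 * (1 - eps) ^+ k) ->
  exists2 J, independent E J &
    #|S|%:R * x0 * (gain eps L tau k -
      expR (del * L) ^+ k * (x0 * expR (D * x0 ^+ r) / tau)) <= #|J|%:R.
Proof.
move=> x00 degS xw tk.
have wS v : v \in S -> link_weight E (value finset.set0 S (fun=> x0)) v <= D * x0 ^+ r.
  move=> vS; have := degS v vS => /(ler_wpM2r (exprn_ge0 r (ltW x00))); apply: le_trans.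
  rewrite -sum1_card natr_sum mulr_suml /link_weight.
  rewrite (bigID (fun e : {set T} => e \subset S)) /= [X in _ + X]big1 ?addr0; last first.
    (* An edge that leaves [S] has a link vertex of value 0, so only the edges inside [S] count. *)
    move=> e /andP[/andP[eE ve] /fintype.subsetPn[u ue uS]].
    have uv : u != v by apply: contraNneq uS => ->.
    by rewrite (bigD1 u) ?inE ?uv //= /value inE (negPf uS) mul0r.
  rewrite [X in _ <= X](eq_bigl (fun e => (e \in E) && (v \in e) && (e \subset S))); last first.
    by move=> e; rewrite inE andbA.
  apply: ler_sum => e /andP[/andP[eE ve] eS].
  have card_e : #|e :\ v| = r.
    by have := unifE eE; rewrite (cardsD1 v) ve => -[].
  rewrite mul1r -card_e -prodr_const; apply: ler_prod => u _.
  by rewrite /value inE; case: ifP => _; rewrite ?lexx ltW.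
have st : nibble_state E tau x0 finset.set0 S (fun=> x0).
  split=> //.
  - by apply/pred0P => v; rewrite /= inE.
  - apply/forall_inP => e eE; rewrite finset.subset0 -card_gt0.
    by rewrite (unifE eE).
  - move=> u e _ eE ue; rewrite finset.subset0 -card_gt0.
    by have := unifE eE; rewrite (cardsD1 u) ue add1n => -[->].
  - move=> v vS; apply: le_trans xw; rewrite ler_wpM2l ?ler_expR ?wS //; exact: ltW.
have [J indJ leJ] := nibble_iter st x00 tk; exists J => //.
apply: le_trans leJ; rewrite /potential cards0 add0r sumr_const -[x0 *+ _]mulr_natl.
rewrite mulrBr; apply: lerB; first by rewrite mulrC.
apply: le_trans (_ : expR (del * L) ^+ k / tau *
   \sum_(v in S) x0 ^+ 2 * expR (D * x0 ^+ r) <= _).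
  rewrite ler_wpM2l ?divr_ge0 ?exprn_ge0 ?expR_ge0 ?(ltW tau0) //.
  by apply: ler_sum => v vS; rewrite ler_wpM2l ?sqr_ge0 // ler_expR wS.
rewrite sumr_const -[_ * _ *+ _]mulr_natl le_eqVlt; apply/orP; left; apply/eqP.
by rewrite expr2; field; rewrite gt_eqF.
Qed.

End Iteration.

(** * Choice of the parameters *)

Section Asymptotics.
Context (R : realType).

Lemma powR_invnK (r : nat) (y : R) : (0 < r)%N -> 0 <= y ->
  (y `^ (r%:R^-1)) ^+ r = y.
Proof.
move=> r0 y0; rewrite -powR_mulrn ?powR_ge0 // -powRrM mulVf ?powRr1 //.
by rewrite pnatr_eq0 -lt0n.
Qed.

Lemma le_root (r : nat) (a b : R) : (0 < r)%N -> 0 <= a -> 0 <= b ->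
  a ^+ r <= b ^+ r -> a <= b.
Proof. by move=> r0 a0 b0; rewrite ler_pXn2r. Qed.

Lemma cube_expR_small (s kappa : R) : 0 < s -> 0 < kappa ->
  exists l0, forall l, l0 <= l -> l ^+ 3 * expR (- (s * l)) <= kappa.
Proof.
move=> s0 k0; have sk : 0 < s ^+ 4 * kappa by rewrite mulr_gt0 ?exprn_gt0.
(* Here 24 is [4!], from the degree 4 term of the exponential series. *)
exists (24 / (s ^+ 4 * kappa)) => l; rewrite ler_pdivrMr // => hl.
have l0 : 0 < l by rewrite -(pmulr_lgt0 _ sk); apply: lt_le_trans hl.
rewrite expRN ler_pdivrMr ?expR_gt0 //.
have sl : 0 <= s * l by rewrite mulr_ge0 // ltW.
have /(ler_wpM2l (ltW k0)) := @expR_ge1Dxn R _ 3 sl; apply: le_trans.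
rewrite (_ : 4`!%:R = 24) //.
have : 24 * l ^+ 3 <= l * (s ^+ 4 * kappa) * l ^+ 3.
  by rewrite ler_wpM2r // exprn_ge0 // ltW.
have -> : l * (s ^+ 4 * kappa) * l ^+ 3 = kappa * (s * l) ^+ 4 by ring.
rewrite mulrDr mulr1 mulrA; lra.
Qed.

Lemma expR_le_1m (eps : R) : 0 <= eps <= 2^-1 -> expR (- (2 * eps)) <= 1 - eps.
Proof.
move=> /andP[e0 e1]; rewrite expRN -[leLHS]mul1r ler_pdivrMr ?expR_gt0 //.
have : (1 - eps) * (1 + 2 * eps) <= (1 - eps) * expR (2 * eps).
  by rewrite ler_wpM2l ?expR_ge1Dx //; lra.
by apply: le_trans; nra.
Qed.

Lemma nat_expRN_small (h : R) : 0 < h -> exists c : nat, expR (- c%:R) <= h.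
Proof.
move=> h0; have hV : 0 <= h^-1 by rewrite invr_ge0 ltW.
have /andP[_ /ltW hc] := truncn_itv hV; exists (Num.truncn h^-1).+1.
set c := _.+1%:R in hc *; rewrite expRN invf_ple ?posrE ?expR_gt0 //.
by apply: le_trans hc _; apply: le_trans (expR_ge1Dx _); rewrite lerDr.
Qed.

(** Take [eps = 1 / M] for an integer [M] just above [l ^+ 2], so that [k = c * M] makes [eps * k]
    exactly [c]. *)
Lemma nibble_rate (l : R) (c : nat) : 2 <= l -> exists (eps : R) (k : nat),
  [/\ 0 < eps, eps <= 4^-1, eps * l * l <= 1, eps * k%:R = c%:R
    & k%:R <= c%:R * (l ^+ 2 + 1)].
Proof.
move=> l2; have l20 : 0 <= l ^+ 2 by rewrite sqr_ge0.
pose M : R := (Num.truncn (l ^+ 2)).+1%:R.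
have /andP[M1 M2] : l ^+ 2 <= M <= l ^+ 2 + 1.
  have /andP[a b] := truncn_itv l20.
  by rewrite (ltW b) /= /M -natr1 lerD2r.
have Ml : 4 <= M.
  by apply: le_trans M1; have := ler_pM (ler0n R 2) (ler0n R 2) l2 l2; rewrite expr2; lra.
have M0 : 0 < M by apply: lt_le_trans Ml; rewrite ltr0n.
have eM : M^-1 * M = 1 by rewrite mulVf // gt_eqF.
exists M^-1, (c * (Num.truncn (l ^+ 2)).+1)%N; rewrite natrM -/M; split.
- by rewrite invr_gt0.
- by rewrite lef_pV2 ?posrE.
- by rewrite -mulrA -expr2 -eM ler_wpM2l // invr_ge0 ltW.
- by rewrite mulrCA eM mulr1.
- by rewrite ler_wpM2l.
Qed.

(** With [l] as [L] and [t] as [tau], the error exponent accumulated over [kk] rounds is bounded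
    independently of [l]: [eps^2 l^2 kk <= c] and [l t kk <= 2 c kappa]. *)
Lemma nibble_error (rr c eps kk l t kappa : R) :
  2 <= rr -> 0 <= c -> 0 < eps -> eps <= 4^-1 -> 2 * rr <= l -> eps * l * l <= 1 ->
  eps * kk = c -> kk <= c * (l ^+ 2 + 1) -> 0 < t -> l ^+ 3 * t <= kappa ->
  40 * (rr * c * kappa) <= 1 -> 40 * (rr * kappa) <= 1 ->
  rr * (eps ^+ 2 * l + 20 * t) <= 1 /\
  rr * (eps ^+ 2 * l + 20 * t) * l * kk <= rr * c + 1.
Proof.
move=> rr2 c0 e0 e4 lr ell ek kk_le t0 ltk krc krr.
have rr0 : 0 < rr by apply: lt_le_trans rr2; rewrite ltr0n.
have l2 : 2 <= l by lra.
have lt1 : l * t <= kappa.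
  by apply: le_trans ltk; rewrite ler_wpM2r ?(ltW t0) // ler_eXnr //; lra.
have tk : t <= kappa by apply: le_trans lt1; rewrite ler_peMl ?(ltW t0) //; lra.
have el0 : 0 <= eps * l by rewrite mulr_ge0 ?ltW //; lra.
have elr : rr * (eps * l) <= 2^-1 by have := ler_wpM2l el0 lr; lra.
split.
  have h1 : eps * (rr * (eps * l)) <= 4^-1 * 2^-1.
    by apply: ler_pM => //; [exact: ltW|rewrite mulr_ge0 // ltW].
  have h2 : rr * t <= rr * kappa by rewrite ler_wpM2l // ltW.
  rewrite expr2; lra.
have -> : rr * (eps ^+ 2 * l + 20 * t) * l * kk =
    rr * (eps * kk) * (eps * l * l) + 20 * (rr * (l * t * kk)) by ring.
have rc0 : 0 <= rr * c by rewrite mulr_ge0 // ltW.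
rewrite ek; have h1 : rr * c * (eps * l * l) <= rr * c * 1 by rewrite ler_wpM2l.
have h2 : l * t * kk <= c * (2 * kappa).
  apply: le_trans (_ : l * t * (c * (l ^+ 2 + 1)) <= _).
    by rewrite ler_wpM2l // mulr_ge0 ?(ltW t0) //; lra.
  have -> : l * t * (c * (l ^+ 2 + 1)) = c * (l ^+ 3 * t + l * t) by ring.
  by rewrite ler_wpM2l //; lra.
have := ler_wpM2l (ltW rr0) h2; lra.
Qed.

(** Here [w] is the initial link weight. The factor [1 - h] in it yields
    [x exp(w) <= l exp(- h l / r) = l t^2], below [t] once [l t <= 1]. *)
Lemma initial_density (r : nat) (h l : R) : (2 <= r)%N -> 0 < h -> h <= 5^-1 ->
  2 * r%:R <= l ->
  let D := expR l in let w := (1 - h) * l / r%:R in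
  let t := expR (- (h / (2 * r%:R) * l)) in
  exists2 x, 0 < x &
    [/\ D * x ^+ r = w, expR (- (l / r%:R)) <= x, x * expR w <= l * t * t
      & (1 - h) * (l / (r%:R * D)) `^ (r%:R^-1) <= x].
Proof.
move=> r2 h0 h5; have r0 : (0 < r)%N by apply: leq_trans r2.
set rr : R := r%:R; have rr2 : 2 <= rr by rewrite ler_nat.
have rr0 : 0 < rr by lra.
move=> lr D w t; have Dp : 0 < D by exact: expR_gt0.
have w1 : 1 <= w.
  rewrite /w ler_pdivlMr // mul1r.
  have : h * l <= 5^-1 * l by rewrite ler_wpM2r //; lra.
  lra.
have wl : w <= l.
  rewrite /w ler_pdivrMr //.
  have : l * 1 <= l * rr by rewrite ler_wpM2l //; lra.
  have : 0 <= h * l by rewrite mulr_ge0 //; lra.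
  lra.
pose x := (w / D) `^ (rr^-1).
have w0 : 0 <= w by lra.
have l0 : 0 <= l by lra.
have l1 : 1 <= l by lra.
have xr : x ^+ r = w / D by rewrite powR_invnK // divr_ge0 // ltW.
have x0 : 0 <= x by exact: powR_ge0.
pose a := expR (- (l / rr)).
have a0 : 0 < a by exact: expR_gt0.
have ar : a ^+ r = D^-1.
  by rewrite -expRM_natr mulNr divfK ?gt_eqF // expRN.
have ax : a <= x.
  apply: (le_root r0 (ltW a0)) => //.
  by rewrite ar xr ler_peMl // invr_ge0 ltW.
have xa : x <= l * a.
  apply: (le_root r0) => //; first by rewrite mulr_ge0 ?(ltW a0).
  rewrite exprMn ar xr ler_wpM2r ?invr_ge0 ?(ltW Dp) //.
  by apply: le_trans wl _; rewrite ler_eXnr.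
exists x; first exact: lt_le_trans ax.
split=> //.
- by rewrite xr mulrCA mulfV ?mulr1 // gt_eqF.
- apply: le_trans (_ : l * a * expR w <= _); first by rewrite ler_wpM2r ?expR_ge0.
  rewrite -!mulrA -!expRD ler_wpM2l //.
  rewrite ler_expR /w le_eqVlt; apply/orP; left; apply/eqP; field.
  by rewrite gt_eqF.
have h1 : 0 <= 1 - h by lra.
apply: (le_root r0) => //; first by rewrite mulr_ge0 // powR_ge0.
have q0 : 0 <= l / (rr * D) by rewrite divr_ge0 // mulr_ge0 ?ltW.
rewrite exprMn xr powR_invnK //.
have -> : w / D = (1 - h) * (l / (rr * D)) by rewrite /w; field; rewrite !gt_eqF.
by rewrite ler_wpM2r // ler_iXnr // gerBl ltW.
Qed.

Lemma gain_enough (h t g q p : R) : 0 <= h -> h <= 1 -> 0 <= g -> t <= h ->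
  q <= h -> p <= h -> (1 - q) * (1 - p) <= (1 + t) * g -> 1 - 3 * h <= g.
Proof.
move=> h0 h1 g0 th qh ph qp.
have : (1 - h) * (1 - h) <= (1 - q) * (1 - p) by apply: ler_pM; lra.
have : (1 + t) * g <= (1 + h) * g by rewrite ler_wpM2r //; lra.
have := sqr_ge0 h; rewrite expr2 => hh a b.
have h1p : 0 < 1 + h by lra.
rewrite -(ler_pM2l h1p); lra.
Qed.

(** The process runs with [L = ln D], [tau = D^(- h / (2 r))], [eps] about [1 / L^2] and about
    [c L^2] rounds. The loss [5 h] consists of [3 h] from the gain, [h] from the potential and [h]
    from the initial density. *)
Lemma max_degree_independent (r : nat) (h : R) : (2 <= r)%N -> 0 < h -> h <= 5^-1 ->
  exists2 D0 : R, 0 < D0 & forall (T : finType) (E : {set {set T}}) (S : {set T}) (D : R),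
    uniform r.+1 E -> uncrowded E -> D0 <= D ->
    (forall v, v \in S -> #|[set e in E | (v \in e) && (e \subset S)]|%:R <= D) ->
    exists2 J, independent E J &
      (1 - 5 * h) * (ln D / (r%:R * D)) `^ (r%:R^-1) * #|S|%:R <= #|J|%:R.
Proof.
move=> r2 h0 h5; have r0 : (0 < r)%N by apply: leq_trans r2.
set rr : R := r%:R; have rr2 : 2 <= rr by rewrite ler_nat.
have rr0 : 0 < rr by lra.
(* As [eps * k = c], the factor [(1 - eps) ^+ k] is at most [expR (- c) <= h] at the end. *)
have [c0 hc] := nat_expRN_small h0; set c : R := c0%:R in hc.
have c_ge0 : 0 <= c by rewrite ler0n.
have rc0 : 0 <= rr * c by rewrite mulr_ge0 // ltW.
(* [N] secures the smallness conditions of [nibble_error]; the exponential in [kappa] offsets the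
   accumulated error [expR (rr * c + 1)]. *)
pose N := 80 * (rr * c + rr).
pose kappa := h * expR (- (rr * c + 1)) / N.
have N0 : 1 <= N by rewrite /N; lra.
have N00 : 0 < N by lra.
have k0 : 0 < kappa by rewrite divr_gt0 // mulr_gt0 ?expR_gt0.
have kN : kappa * N = h * expR (- (rr * c + 1)) by rewrite divfK ?gt_eqF.
have kkN : kappa <= h * expR (- (rr * c + 1)) by rewrite -kN ler_peMr // ltW.
have kNh : kappa * N <= h.
  by rewrite kN ler_piMr ?(ltW h0) // -[leRHS]expR0 ler_expR; lra.
have [krc krr] : 40 * (rr * c * kappa) <= 1 /\ 40 * (rr * kappa) <= 1.
  have a : 0 <= rr * c * kappa by rewrite mulr_ge0 // ltW.
  have b : 0 <= rr * kappa by rewrite mulr_ge0 // ltW.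
  move: kNh; rewrite /N => d; clear - a b d h5; split; lra.
have kh : kappa <= h by apply: le_trans kNh; rewrite ler_peMr // ltW.
have hs : 0 < h / (2 * rr) by rewrite divr_gt0 // mulr_gt0.
have [l1 hl1] := cube_expR_small hs k0.
pose l0 := `|l1| + 4 * c + 2 * rr + h^-1 + 2.
exists (expR l0) => [|T E S D unifE uncE D0D degS]; first exact: expR_gt0.
have Dp : 0 < D by apply: lt_le_trans D0D; exact: expR_gt0.
set l := ln D; have DE : D = expR l by rewrite /l lnK.
have hl : l0 <= l by rewrite -ler_expR -DE.
have [l2 lr lc lV ll1] : [/\ 2 <= l, 2 * rr <= l, 4 * c <= l, h^-1 <= l & l1 <= l].
  have nl1 : 0 <= `|l1| by [].
  have hV : 0 < h^-1 by rewrite invr_gt0.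
  have nl : l1 <= `|l1| by exact: ler_norm.
  by move: hl; rewrite /l0 => hl; clear - hl nl1 hV nl c_ge0 rr0; split; lra.
have lh : 1 <= h * l by rewrite -(mulfV (lt0r_neq0 h0)) ler_wpM2l // ltW.
have l_ge0 : 0 <= l by lra.
have {}hl1 := hl1 l ll1; set t := expR _ in hl1.
have t0 : 0 < t by exact: expR_gt0.
have ltk : l * t <= kappa.
  by apply: le_trans hl1; rewrite ler_wpM2r ?(ltW t0) // ler_eXnr //; lra.
have tk : t <= kappa by apply: le_trans ltk; rewrite ler_peMl ?(ltW t0) //; lra.
have th : t <= h by exact: le_trans kh.
have [eps [k [e0 e4 ell ek kle]]] := nibble_rate c0 l2.
have [del1 delk] := nibble_error rr2 c_ge0 e0 e4 lr ell ek kle t0 hl1 krc krr.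
have el0 : 0 <= eps * l by rewrite mulr_ge0 // ltW.
have elh : eps * l <= h.
  have a : (eps * l) * 1 <= (eps * l) * (h * l) by rewrite ler_wpM2l.
  have b : h * (eps * l * l) <= h * 1 by rewrite ler_wpM2l // ltW.
  by clear - a b; lra.
have el2 : eps * l <= 2^-1 by apply: le_trans elh _; clear - h5; lra.
have beta : expR (rr * (eps ^+ 2 * l + 20 * t) * l) ^+ k <= expR (rr * c + 1).
  by rewrite -expRM_natr ler_expR.
have [x x0 [Dx ax xw yx]] := initial_density r2 h0 h5 lr.
rewrite -DE -/t -/rr in Dx xw yx; set w := _ / _ in Dx xw.
have ratio : x * expR w / t <= kappa.
  by apply: le_trans ltk; rewrite ler_pdivrMr.
have C1 : x * expR (D * x ^+ r) <= t.
  rewrite Dx; apply: le_trans xw _; rewrite ler_piMl ?(ltW t0) //.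
  by apply: le_trans ltk _; clear - kh h5; lra.
have e1 : 0 <= 1 - eps by clear - e4; lra.
have e01 : 0 < eps < 1 by rewrite e0 /=; clear - e4; lra.
have e02 : 0 <= eps <= 2^-1 by rewrite (ltW e0) /=; clear - e4; lra.
have pk_ge : expR (- (2 * c)) <= (1 - eps) ^+ k.
  rewrite (_ : - (2 * c) = - (2 * eps) * k%:R); last by rewrite /c -ek; ring.
  by rewrite expRM_natr; apply: lerXn2r; rewrite ?nnegrE ?expR_ge0 ?expR_le_1m.
have pk_le : (1 - eps) ^+ k <= h.
  apply: le_trans hc; rewrite /c -ek -mulNr expRM_natr.
  by apply: lerXn2r; rewrite ?nnegrE ?expR_ge0 ?expR_ge1Dx.
(* The right side is at least [exp(l - l / r - 2 c) >= 1], since [r >= 2] and [4 c <= l]. *)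
have C2 : t <= expR l * (x * (1 - eps) ^+ k).
  apply: le_trans (_ : expR l * (expR (- (l / rr)) * expR (- (2 * c))) <= _); last first.
    by rewrite ler_wpM2l ?expR_ge0 // ler_pM // ?expR_ge0.
  apply: le_trans (_ : 1 <= _); first by clear - th h5; lra.
  rewrite -!expRD -[leLHS]expR0 ler_expR.
  have : l / rr <= l / 2 by rewrite ler_wpM2l // lef_pV2 ?posrE.
  by clear - lc; lra.
have [J indJ leJ] := nibble_from_uniform unifE uncE r0 e01 t0 l_ge0 el2 del1
  x0 degS C1 C2.
exists J => //; apply: le_trans leJ.
rewrite [leLHS]mulrC -mulrA ler_wpM2l // Dx.
have /andP[g0 g1] := gain_01 r0 e01 t0 l_ge0 el2 del1 k.
have gg := gain_ge r0 e01 t0 l_ge0 el2 del1 k.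
set g := gain _ _ _ _ in g0 g1 gg *.
have h1 : h <= 1 by clear - h5; lra.
have g3 : 1 - 3 * h <= g := gain_enough (ltW h0) h1 g0 th elh pk_le gg.
have bb : expR (rr * (eps ^+ 2 * l + 20 * t) * l) ^+ k * (x * expR w / t) <= h.
  apply: le_trans (_ : expR (rr * c + 1) * kappa <= _).
    apply: ler_pM; [by rewrite exprn_ge0 ?expR_ge0| |exact: beta|exact: ratio].
    by apply: divr_ge0; [apply: mulr_ge0; [exact: ltW|exact: expR_ge0]|exact: ltW].
  have := ler_wpM2l (expR_ge0 (rr * c + 1)) kkN.
  by rewrite (_ : expR _ * (h * _) = h) // mulrCA -expRD subrr expR0 mulr1.
set y := _ `^ _ in yx *; have y0 : 0 <= y by exact: powR_ge0.
set B := _ * (x * _ / _) in bb *.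
apply: le_trans (_ : x * (1 - 4 * h) <= _); last first.
  by rewrite ler_wpM2l ?(ltW x0) //; clear - bb g3; lra.
apply: le_trans (_ : (1 - h) * y * (1 - 4 * h) <= _); last first.
  by rewrite ler_wpM2r //; clear - h5; lra.
have := mulr_ge0 (sqr_ge0 h) y0; rewrite expr2; clear; lra.
Qed.

End Asymptotics.

(** * From average degree to maximum degree, and the theorem *)

Lemma degree_sum (T : finType) (k : nat) (E : {set {set T}}) :
  uniform k E -> (\sum_v degree E v = k * #|E|)%N.
Proof.
move=> unifE; transitivity (\sum_(e in E) #|e|)%N; last first.
  rewrite (eq_bigr (fun=> k)) => [|e eE]; last exact: unifE.
  by rewrite sum_nat_const mulnC.
transitivity (\sum_v \sum_(e in E) (v \in e))%N.
  apply: eq_bigr => v _; rewrite /degree -sum1_card big_mkcond [RHS]big_mkcond /=.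
  by apply: eq_bigr => e _; rewrite inE; case: (e \in E); case: (v \in e).
rewrite exchange_big; apply: eq_bigr => e _.
by rewrite -sum1_card [RHS]big_mkcond; apply: eq_bigr => v _; case: (v \in e).
Qed.

(* A maximizer [S] of [|S|^(r+1) / (e(S) + b)] has no vertex of degree above
   [(r+1) (e(S) + b) / |S|], the average degree of [S] when [b = 0]; the shift
   [b] keeps this bound above [D0]. *)
Lemma regular_subset (R : realType) (r : nat) (T : finType) (E : {set {set T}}) (D0 : R) :
  uniform r.+1 E -> (0 < #|T|)%N -> 0 < D0 ->
  exists (S : {set T}) (D : R), [/\ D0 <= D,
    forall v, v \in S -> #|[set e in E | (v \in e) && (e \subset S)]|%:R <= D
    & #|T|%:R ^+ r * D <= #|S|%:R ^+ r * (average_degree R E + D0)].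
Proof.
move=> unifE T0 D00; set n : R := #|T|%:R; have n0 : 0 < n by rewrite ltr0n.
set d := average_degree R E.
have nd : n * d = r.+1%:R * #|E|%:R.
  by rewrite /d /average_degree mulrA mulfV ?gt_eqF // mul1r -natr_sum (degree_sum unifE) natrM.
have rp : 0 < r.+1%:R :> R by rewrite ltr0n.
pose b := n * D0 / r.+1%:R; have b0 : 0 < b by rewrite divr_gt0 // mulr_gt0.
have rb : r.+1%:R * b = n * D0 by rewrite mulrCA mulfV ?mulr1 // gt_eqF.
pose ed (S : {set T}) : R := #|[set e in E | e \subset S]|%:R.
have edb S : 0 < ed S + b by rewrite ltr_wpDl.
pose F (S : {set T}) : R := #|S|%:R ^+ r.+1 / (ed S + b).
have [S _ maxS] := @arg_maxP _ _ _ [set: T] predT F isT.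
have FT : 0 < F [set: T] by rewrite divr_gt0 // exprn_gt0 // cardsT.
have s0 : 0 < #|S|%:R :> R.
  rewrite ltr0n lt0n; apply: contraTneq (maxS [set: T] isT) => S0.
  by rewrite /= -ltNge /F S0 expr0n mul0r.
set s : R := #|S|%:R in s0.
exists S, (r.+1%:R * (ed S + b) / s); split.
- rewrite ler_pdivlMr // mulrDr rb.
  apply: le_trans (_ : n * D0 <= _); last by rewrite lerDr mulr_ge0 // ltW.
  by rewrite mulrC ler_wpM2r ?(ltW D00) // ler_nat max_card.
- move=> v vS; set dv : R := #|_|%:R.
  have edv : ed (S :\ v) + dv = ed S.
    rewrite /ed /dv -natrD -(cardsID [set e : {set T} | v \in e] [set e in E | e \subset S]).
    rewrite addnC; congr (_ + _)%:R; apply: eq_card => e; rewrite !inE.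
      by case: (e \in E); rewrite //= andbC.
    by rewrite subsetD1; case: (e \in E); rewrite //= ?andbF // andbC.
  have sv : #|S :\ v|%:R = s - 1 :> R.
    by rewrite /s (cardsD1 v S) vS natrD addrAC subrr add0r.
  (* Maximality against [S :\ v], with Bernoulli's inequality for [(1 - 1/s)^(r+1)], bounds the
     degree of [v]. *)
  have := maxS (S :\ v) isT; rewrite /= /F sv.
  rewrite ler_pdivrMr // mulrAC ler_pdivlMr //.
  have -> : (s - 1) ^+ r.+1 = s ^+ r.+1 * (1 - s^-1) ^+ r.+1.
    by rewrite -exprMn mulrBr mulr1 mulfV // gt_eqF.
  rewrite -[X in X <= _]mulrA ler_pM2l ?exprn_gt0 // => h.
  have s1 : 0 <= s^-1 <= 1.
    by rewrite invr_ge0 ltW //= invf_le1 // ler1n lt0n -(pnatr_eq0 R) gt_eqF.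
  have /(ler_wpM2r (ltW (edb S))) h' := exp_1m_ge r.+1 s1.
  have : (1 - r.+1%:R * s^-1) * (ed S + b) <= ed (S :\ v) + b := le_trans h' h.
  rewrite -edv mulrBl mul1r => h2.
  have -> : r.+1%:R * (ed (S :\ v) + dv + b) / s =
      r.+1%:R * s^-1 * (ed (S :\ v) + dv + b) by rewrite mulrAC.
  by move: h2; lra.
(* Maximality against the whole vertex set gives the last claim. *)
have := maxS [set: T] isT; rewrite /= /F cardsT -/s -/n.
have -> : ed [set: T] = #|E|%:R.
  by congr (_%:R); apply: eq_card => e; rewrite !inE finset.subsetT andbT.
have Eb : 0 < #|E|%:R + b by rewrite ltr_wpDl.
rewrite ler_pdivrMr // mulrAC ler_pdivlMr // => h.
have Ebd : r.+1%:R * (#|E|%:R + b) = n * (d + D0).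
  by rewrite mulrDr -nd rb -mulrDr.
rewrite !mulrA ler_pdivrMr // -(ler_pM2l n0).
move: h => /(ler_wpM2l (ltW rp)); rewrite !exprS.
have -> : r.+1%:R * (n * n ^+ r * (ed S + b)) = n * (n ^+ r * r.+1%:R * (ed S + b)) by ring.
move/le_trans; apply.
have -> : r.+1%:R * (s * s ^+ r * (#|E|%:R + b)) = s * s ^+ r * (r.+1%:R * (#|E|%:R + b)).
  by ring.
by rewrite Ebd le_eqVlt; apply/orP; left; apply/eqP; ring.
Qed.

Lemma independent_le (T : finType) (E : {set {set T}}) (J : {set T}) :
  independent E J -> (#|J| <= independence_number E)%N.
Proof. by move=> indJ; apply: (leq_bigmax_cond (F := fun S : {set T} => #|S|)). Qed.

(** After taking [r]-th powers, [D >= h d] costs a factor [1 - h] in the logarithm and the shift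
    [h d] a factor [1 + h]; then [(1 - h) / (1 + h) >= 1 - 2 h >= (1 - 2 h)^r]. *)
Lemma ln_density_compare (R : realType) (r : nat) (h d D s n : R) : (0 < r)%N ->
  0 < h -> h <= 2^-1 -> 1 < d -> - ln h <= h * ln d -> h * d <= D ->
  0 <= s -> 0 <= n -> n ^+ r * D <= s ^+ r * (d + h * d) ->
  (1 - 2 * h) * (r%:R `^ (- r%:R^-1) * (ln d / d) `^ (r%:R^-1) * n) <=
  (ln D / (r%:R * D)) `^ (r%:R^-1) * s.
Proof.
move=> r0 h0 h2 d1 lnh hdD s0 n0 hs.
have rr : 0 < r%:R :> R by rewrite ltr0n.
have d0 : 0 < d by apply: lt_trans d1.
have ld : 0 < ln d by rewrite ln_gt0.
have D0 : 0 < D by apply: lt_le_trans hdD; rewrite mulr_gt0.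
have lD : (1 - h) * ln d <= ln D.
  apply: le_trans (_ : ln (h * d) <= _); last by rewrite ler_ln ?posrE ?mulr_gt0.
  by rewrite lnM ?posrE // mulrBl mul1r addrC lerD2r lerNl.
have lD0 : 0 <= ln D.
  by apply: le_trans lD; rewrite mulr_ge0 ?(ltW ld) //; lra.
have h12 : 0 <= 1 - 2 * h by lra.
apply: (le_root r0).
- by rewrite !mulr_ge0 ?powR_ge0.
- by rewrite mulr_ge0 ?powR_ge0.
rewrite powRN.
have q1 : 0 <= ln d / d by rewrite divr_ge0 // ltW.
have q2 : 0 <= ln D / (r%:R * D) by rewrite divr_ge0 // mulr_ge0 // ltW.
have := powR_invnK r0 q1; have := powR_invnK r0 q2; have := powR_invnK r0 (ltW rr).
set y1 := _ `^ _; set y2 := _ `^ _; set y3 := _ `^ _ => y1r y2r y3r.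
rewrite !exprMn exprVn y1r y2r y3r.
apply: le_trans (_ : (1 - 2 * h) * (r%:R^-1 * (ln d / d) * n ^+ r) <= _).
  rewrite ler_wpM2r // ?ler_iXnr //; last by lra.
  by rewrite !mulr_ge0 ?exprn_ge0 ?invr_ge0 ?(ltW rr) ?(ltW ld) ?(ltW d0).
have -> : ln D / (r%:R * D) * s ^+ r = r%:R^-1 * (ln D * (s ^+ r / D)).
  by field; rewrite !gt_eqF.
have -> : (1 - 2 * h) * (r%:R^-1 * (ln d / d) * n ^+ r) =
    r%:R^-1 * ((1 - 2 * h) * ln d * (n ^+ r / d)) by ring.
rewrite ler_wpM2l ?invr_ge0 ?(ltW rr) //.
have hp : 0 < 1 + h by lra.
have sD : n ^+ r / d / (1 + h) <= s ^+ r / D.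
  rewrite -mulrA -invfM ler_pdivrMr ?mulr_gt0 // mulrAC ler_pdivlMr //.
  by rewrite mulrDr mulr1 [d * h]mulrC.
have nd : 0 <= n ^+ r / d by rewrite divr_ge0 ?exprn_ge0 // ltW.
apply: le_trans (_ : (1 - h) * ln d * (n ^+ r / d / (1 + h)) <= _); last first.
  apply: ler_pM => //; first by rewrite mulr_ge0 ?(ltW ld) //; lra.
  by rewrite divr_ge0 // ltW.
have hh : 1 - 2 * h <= (1 - h) / (1 + h).
  by rewrite ler_pdivlMr //; have := sqr_ge0 h; rewrite expr2; lra.
set X := n ^+ r / d in nd *; set i := (1 + h)^-1 in hh *.
have -> : (1 - h) * ln d * (X * i) = (1 - h) * i * ln d * X by ring.
by rewrite ler_wpM2r // ler_wpM2r // ltW.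
Qed.

Theorem theorem1p1 (R : realType) (r : nat) (eta : R) (hr : (2 <= r)%N)
    (heta : 0 < eta) :
  exists d_star : R,
    forall (T : finType) (E : {set {set T}}),
      uniform r.+1 E ->
      uncrowded E ->
      d_star <= average_degree R E ->
      (1 - eta) * (r%:R `^ (- r%:R^-1))
        * ((ln (average_degree R E) / average_degree R E) `^ (r%:R^-1))
        * #|T|%:R
      <= (independence_number E)%:R.
Proof.
have r0 : (0 < r)%N by apply: leq_trans hr.
(* The 7 comes from [(1 - 5 h)(1 - 2 h) >= 1 - 7 h]. *)
have [h [h0 h5 heta']] : exists h : R, [/\ 0 < h, h <= 8^-1 & 7 * h <= eta].
  exists (Num.min (8^-1) (eta / 7)); split.
  - by rewrite lt_min invr_gt0 divr_gt0 // ltr0n.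
  - by rewrite ge_min lexx.
  by rewrite mulrC -ler_pdivlMr // ge_min lexx orbT.
have h5' : h <= 5^-1 by clear - h5; lra.
have h2 : h <= 2^-1 by clear - h5; lra.
have [D0 D00 hD0] := max_degree_independent hr h0 h5'.
(* The summands ensure in turn [D0 <= h * d], [- ln h <= h * ln d] and [1 < d]. *)
exists (D0 / h + expR (- ln h / h) + 1) => T E unifE uncE dle.
set d := average_degree R E in dle *.
have a0 : 0 < D0 / h by rewrite divr_gt0.
have b0 := expR_gt0 (- ln h / h).
have d1 : 1 < d by clear - dle a0 b0; lra.
have dD0 : D0 <= h * d.
  have : D0 / h <= d by clear - dle a0 b0; lra.
  by rewrite ler_pdivrMr // mulrC.
have dln : - ln h <= h * ln d.
  have e : expR (- ln h / h) <= d by clear - dle a0 b0; lra.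
  have : - ln h / h <= ln d.
    by rewrite -[leLHS]expRK ler_ln ?posrE ?expR_gt0 // (lt_trans ltr01).
  by rewrite ler_pdivrMr // mulrC.
have T0 : (0 < #|T|)%N.
  rewrite lt0n; apply: contraTneq d1 => T0.
  by rewrite /d /average_degree T0 invr0 mul0r -leNgt ler01.
have hd0 : 0 < h * d by rewrite mulr_gt0 // (lt_trans ltr01).
(* Shifting by [h * d] keeps [D >= h * d >= D0] and costs only a factor [1 + h]. *)
have [S [D [hdD degS hS]]] := regular_subset unifE T0 hd0.
have [J indJ leJ] := hD0 T E S D unifE uncE (le_trans dD0 hdD) degS.
have := ln_density_compare r0 h0 h2 d1 dln hdD (ler0n _ _) (ler0n _ _) hS.
set A := _ * _ * _; set y := _ `^ _ in leJ * => cmp.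
have A0 : 0 <= A by rewrite !mulr_ge0 ?powR_ge0.
apply: le_trans (_ : #|J|%:R <= _); last by rewrite ler_nat independent_le.
apply: le_trans leJ; rewrite -!mulrA (mulrA (r%:R `^ _)) -/A.
have p5 : 0 <= 1 - 5 * h by clear - h5; lra.
apply: le_trans (ler_wpM2l p5 cmp); rewrite [leRHS]mulrA ler_wpM2r //.
have := sqr_ge0 h; rewrite expr2; clear - heta'; lra.
Qed.
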